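(* Let $d\equiv 2\pmod 4$ be a positive square-free integer. Set $\mathbb{K}=\mathbb{Q}(\sqrt{d})$, a real quadratic number field of discriminant $d_{\mathbb{K}}=4d$ and ring of algebraic integers $\mathbb{Z}[\sqrt{d}]$. Assume that $M_{even}'(d)\leq 2$. Then the class number of $\mathbb{K}$ divides $16$.
   Context: For an integer $n\geq 2$, $\omega(n)$ denotes the number of distinct prime divisors of $n$. For a positive integer $d\equiv 2\pmod 4$, $M_{even}'(d):=\max\{\omega(d-x^2) : x \text{ an even integer with } 2\leq x\leq\sqrt d\}$, where the maximum of the empty set (which occurs for $d=2$) is taken to be $0$. *)

(* Defs.v *)
From HB Require Import structures.
From mathcomp Require Import all_boot all_order all_algebra all_field.
From mathcomp Require Import finmap.
From mathcomp Require Import boolp classical_sets functions cardinality.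

Set Implicit Arguments.
Unset Strict Implicit.
Unset Printing Implicit Defensive.

Import GRing.Theory.

Local Open Scope ring_scope.
Local Open Scope classical_set_scope.

Definition squarefree (n : nat) : Prop :=
  forall m : nat, (m ^ 2 %| n)%N -> m = 1%N.

Definition omega (n : nat) : nat := size (primes n).

(* The condition x <= sqrt d is written x ^ 2 <= d, so the subtraction
   d - x ^ 2 is never truncated; an empty maximum is 0. *)
Definition M_even' (d : nat) : nat :=
  (\max_(2 <= x < d.+1 | ~~ odd x && (x ^ 2 <= d)) omega (d - x ^ 2))%N.

Section ClassNumber.
Variable K : fieldExtType rat.

Definition integer_ring : set K :=
  [set x | integralOver (intr : int -> K) x].

Record nonzero_ideal (I : set K) : Prop := NonzeroIdeal {
  ideal_sub : I `<=` integer_ring;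
  ideal0 : I 0;
  idealD : forall x y, I x -> I y -> I (x + y);
  idealMl : forall a x, integer_ring a -> I x -> I (a * x);
  ideal_neq0 : exists2 x, I x & x != 0
}.

Definition ideal_equiv (I J : set K) : Prop :=
  exists a b : K, [/\ integer_ring a, integer_ring b, a != 0, b != 0 &
    [set a * x | x in I] = [set b * x | x in J]].

Definition ideal_class (I : set K) : set (set K) :=
  [set J | nonzero_ideal J /\ ideal_equiv I J].

Definition ideal_classes : set (set (set K)) :=
  [set ideal_class I | I in nonzero_ideal].

(* [fset_set] sends an infinite set to [fset0], so a nonzero value of
   [class_number] entails that there are finitely many ideal classes. *)
Definition class_number : nat := #|` fset_set ideal_classes |.

End ClassNumber.

(* Main.v *)
Require Import Defs.
From mathcomp Require Import all_boot all_order all_fingroup all_algebra all_field.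
From mathcomp Require Import finmap.
From mathcomp Require Import boolp classical_sets functions cardinality.
From mathcomp Require Import zify ring.
From Stdlib Require Import Setoid Morphisms.

(** The class group is generated by ideals [(N, x + s)] with [N ^ 2 <= d] and
    [N | d - x ^ 2] ([reduced_latt]).  For even [x] with [2 <= x <= sqrt d] the
    number [d - x ^ 2] is 2 modulo 4, so the hypothesis says that it is [2 p ^ k]
    with [p] an odd prime ([even_square_complement]).  Write [T] for the prime
    above 2, whose square is [(2)].  The element [x + s], of norm [- 2 p ^ k],
    shows that [P ^ k] is equivalent to [T], where [P = (p, x + s)]
    ([two_mul_exp]), and for [2 p <= sqrt d] playing [x] against [2 p - x]
    shows that [k = 1] for one of the two values, while for larger [p] the size of
    [2 p ^ k] forces [k = 1] or [k = 2] ([prime_square_complement]).  So an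
    unramified prime of norm [p <= sqrt d] is equivalent to [T], except that only
    its square is known to be so in the exceptional case [d = x ^ 2 + 2 p ^ 2].
    In general an odd norm [N <= sqrt d] is a power of such a [p] or a divisor of
    [d], because it divides [d - x ^ 2] for some even [x] with [|x| < N]
    ([generated_odd]).

    Two finiteness statements bound the number of generators.  The choice
    [x = 2 p] shows that [d = 2 q1 q2] where each [qi] is an odd prime or 1
    ([two_odd_primes]); hence the ramified primes contribute [T] and a single
    ideal [A], of square equivalent to 1.  A solution of [d = x ^ 2 + 2 p ^ 2]
    yields square roots of [- 2] modulo [q1] and [q2], and the comparison of their
    signs leaves at most two exceptional primes [P] and [P']
    ([exceptional_at_most_two]).  With [B = P] and [C = P P'], of order dividing 4
    and 2, every ideal is therefore equivalent to some [A ^ i B ^ j C ^ k]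
    ([generated_all]), and the class group is a quotient of a product of cyclic
    groups of orders 2, 4 and 2 ([class_number_dvd_card]). *)

Set Implicit Arguments.
Unset Strict Implicit.
Unset Printing Implicit Defensive.

Import GRing.Theory Num.Theory Order.TTheory.

Local Open Scope ring_scope.

(** * Products and powers of ideals up to equivalence *)

Section IdealProduct.
Local Open Scope classical_set_scope.
Variable K : fieldExtType rat.
Local Notation O := (@integer_ring K).

Lemma integer_ringD x y : O x -> O y -> O (x + y).
Proof. exact: integral_add. Qed.

Lemma integer_ringM x y : O x -> O y -> O (x * y).
Proof. exact: integral_mul. Qed.

Lemma integer_ring_int (n : int) : O n%:~R.
Proof. exact: integral_id. Qed.

Lemma integer_ring1 : O 1.
Proof. exact: (integer_ring_int 1). Qed.

Lemma nonzero_ideal_O : nonzero_ideal O.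
Proof.
split=> //; first exact: (integer_ring_int 0).
- exact: integer_ringD.
- exact: integer_ringM.
- by exists 1; [exact: integer_ring1 | exact: oner_neq0].
Qed.

Lemma ideal_int (I : set K) (n : int) x : nonzero_ideal I -> I x -> I (n%:~R * x).
Proof. by move=> hI Ix; apply: (idealMl hI) => //; apply: integer_ring_int. Qed.

(** Generating the product inductively makes its universal property the
    induction principle. *)
Inductive prod_span (I J : set K) : K -> Prop :=
| prod_span_mul x y : I x -> J y -> prod_span I J (x * y)
| prod_span_add x y : prod_span I J x -> prod_span I J y ->
    prod_span I J (x + y).

Definition ideal_prod (I J : set K) : set K := prod_span I J.

Lemma ideal_prod_gen (I J : set K) x y : I x -> J y -> ideal_prod I J (x * y).
Proof. exact: prod_span_mul. Qed.

Lemma ideal_prod_add (I J : set K) x y :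
  ideal_prod I J x -> ideal_prod I J y -> ideal_prod I J (x + y).
Proof. exact: prod_span_add. Qed.

Lemma ideal_prod_sub (I J L : set K) :
  (forall x y, I x -> J y -> L (x * y)) ->
  (forall x y, L x -> L y -> L (x + y)) -> ideal_prod I J `<=` L.
Proof.
by move=> LM LD z; elim=> {z} [x y Ix Jy|x y _ Lx _ Ly]; [apply: LM|apply: LD].
Qed.

Lemma nonzero_ideal_prod I J :
  nonzero_ideal I -> nonzero_ideal J -> nonzero_ideal (ideal_prod I J).
Proof.
move=> hI hJ; split.
- apply: ideal_prod_sub; last exact: integer_ringD.
  by move=> x y /(ideal_sub hI) Ox /(ideal_sub hJ); apply: integer_ringM.
- by rewrite -(mulr0 0); apply: ideal_prod_gen; apply: ideal0.
- by move=> x y; apply: ideal_prod_add.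
- move=> a x Oa; elim=> {x} [x y Ix Jy|x y _ IHx _ IHy].
    by rewrite mulrA; apply: ideal_prod_gen => //; apply: (idealMl hI).
  by rewrite mulrDr; apply: ideal_prod_add.
- have [x Ix x0] := ideal_neq0 hI; have [y Jy y0] := ideal_neq0 hJ.
  by exists (x * y); [apply: ideal_prod_gen | rewrite mulf_neq0].
Qed.

Lemma ideal_prodC I J : ideal_prod I J = ideal_prod J I.
Proof.
have sub I' J' : ideal_prod I' J' `<=` ideal_prod J' I'.
  apply: ideal_prod_sub; last exact: ideal_prod_add.
  by move=> x y Ix Jy; rewrite mulrC; apply: ideal_prod_gen.
by apply/seteqP; split; apply: sub.
Qed.

Lemma ideal_prodA I J L :
  ideal_prod I (ideal_prod J L) = ideal_prod (ideal_prod I J) L.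
Proof.
have sub A B C :
  ideal_prod (ideal_prod A B) C `<=` ideal_prod A (ideal_prod B C).
  apply: ideal_prod_sub; last exact: ideal_prod_add.
  move=> x z ABx Cz; elim: ABx => {x} [x y Ax By|x y _ IHx _ IHy].
    by rewrite -mulrA; do 2![apply: ideal_prod_gen => //].
  by rewrite mulrDl; apply: ideal_prod_add.
apply/seteqP; split; last exact: sub.
by rewrite (ideal_prodC I) (ideal_prodC J) (ideal_prodC _ L) (ideal_prodC I).
Qed.

Lemma ideal_prod1 I : nonzero_ideal I -> ideal_prod O I = I.
Proof.
move=> hI; apply/seteqP; split.
  by apply: ideal_prod_sub; [apply: idealMl | apply: idealD].
move=> x Ix; rewrite -[x]mul1r; apply: ideal_prod_gen => //.
exact: integer_ring1.
Qed.

Lemma ideal_equiv_refl (I : set K) : ideal_equiv I I.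
Proof. by exists 1, 1; split; rewrite ?oner_neq0 //; apply: integer_ring1. Qed.

Lemma ideal_equiv_sym (I J : set K) : ideal_equiv I J -> ideal_equiv J I.
Proof. by move=> [a [b [Oa Ob a0 b0 e]]]; exists b, a; split. Qed.

Lemma ideal_equiv_trans (I J L : set K) :
  ideal_equiv I J -> ideal_equiv J L -> ideal_equiv I L.
Proof.
have comp (a b : K) (A : set K) :
  [set a * x | x in [set b * x | x in A]] = [set (a * b) * x | x in A].
  by rewrite image_comp; congr image; apply/funext => x /=; rewrite mulrA.
move=> [a [b [Oa Ob a0 b0 e]]] [c [e' [Oc Oe c0 e0 f]]].
exists (c * a), (b * e'); split; rewrite ?mulf_neq0 //; try exact: integer_ringM.
by rewrite -comp e comp (mulrC c) -(comp b c) f comp.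
Qed.

Lemma ideal_equiv_prod (I I' J J' : set K) :
  ideal_equiv I I' -> ideal_equiv J J' ->
  ideal_equiv (ideal_prod I J) (ideal_prod I' J').
Proof.
have half A A' B : ideal_equiv A A' ->
    ideal_equiv (ideal_prod A B) (ideal_prod A' B).
  have sub a b C C' D :
      [set a * x | x in C] = [set b * x | x in C'] ->
      [set a * x | x in ideal_prod C D] `<=` [set b * x | x in ideal_prod C' D].
    move=> e _ [z CDz <-]; elim: CDz => {z} [x y Cx Dy|x y _ [u Cu eu] _ [v Cv ev]].
      have : [set b * x | x in C'] (a * x) by rewrite -e; exists x.
      move=> [x' Cx' eqx]; exists (x' * y); first exact: ideal_prod_gen.
      by rewrite !mulrA eqx.
    by exists (u + v); [apply: ideal_prod_add | rewrite !mulrDr eu ev].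
  move=> [a [b [Oa Ob a0 b0 e]]]; exists a, b; split=> //.
  by apply/seteqP; split; apply: sub.
move=> eI eJ; apply: ideal_equiv_trans (half _ _ J eI) _.
by rewrite (ideal_prodC I') (ideal_prodC I'); apply: half.
Qed.

End IdealProduct.

Add Parametric Relation (K : fieldExtType rat) : (set K) (@ideal_equiv K)
  reflexivity proved by (@ideal_equiv_refl K)
  symmetry proved by (@ideal_equiv_sym K)
  transitivity proved by (@ideal_equiv_trans K) as ideal_equiv_rel.

Add Parametric Morphism (K : fieldExtType rat) : (@ideal_prod K) with
  signature (@ideal_equiv K) ==> (@ideal_equiv K) ==> (@ideal_equiv K)
  as ideal_prod_mor.
Proof. by move=> I I' eI J J' eJ; apply: ideal_equiv_prod. Qed.

Section IdealPowers.
Local Open Scope classical_set_scope.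
Variable K : fieldExtType rat.
Local Notation O := (@integer_ring K).
Local Notation "I ** J" := (ideal_prod I J) (at level 40, left associativity).
Local Notation "I ~ J" := (ideal_equiv I J) (at level 70).

Definition ideal_exp (I : set K) n := iter n (ideal_prod I) O.

Lemma ideal_prodCA (I J L : set K) : I ** (J ** L) = J ** (I ** L).
Proof. by rewrite !ideal_prodA (ideal_prodC I). Qed.

Lemma ideal_prodACA (I J L M : set K) :
  (I ** J) ** (L ** M) = (I ** L) ** (J ** M).
Proof. by rewrite -!ideal_prodA (ideal_prodCA J). Qed.

Lemma nonzero_ideal_exp I n : nonzero_ideal I -> nonzero_ideal (ideal_exp I n).
Proof.
move=> hI; elim: n => [|n IH] /=; first exact: nonzero_ideal_O.
exact: nonzero_ideal_prod.
Qed.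

Lemma ideal_exp1 I : nonzero_ideal I -> ideal_exp I 1 = I.
Proof. by move=> hI; rewrite /= ideal_prodC ideal_prod1. Qed.

Lemma ideal_expD I m n : nonzero_ideal I ->
  ideal_exp I (m + n) = ideal_exp I m ** ideal_exp I n.
Proof.
move=> hI; elim: m => [|m IH] /=.
  by rewrite ideal_prod1 //; apply: nonzero_ideal_exp.
by rewrite IH ideal_prodA.
Qed.

Lemma ideal_exp2 (I : set K) : nonzero_ideal I -> ideal_exp I 2 = I ** I.
Proof. by move=> hI; rewrite -[2%N]/(1 + 1)%N ideal_expD // ideal_exp1. Qed.

Lemma ideal_exp_mod I n k : nonzero_ideal I -> ideal_exp I n ~ O ->
  ideal_exp I k ~ ideal_exp I (k %% n)%N.
Proof.
move=> hI e; rewrite {1}(divn_eq k n); elim: (k %/ n)%N => [|q IH].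
  by rewrite mul0n; reflexivity.
rewrite mulSn -addnA ideal_expD // e ideal_prod1; last exact: nonzero_ideal_exp.
exact: IH.
Qed.

End IdealPowers.

(** * Counting ideal classes with a finite group *)

Section ClassCount.
Local Open Scope classical_set_scope.
Variable K : fieldExtType rat.
Local Notation O := (@integer_ring K).
Local Notation "I ** J" := (ideal_prod I J) (at level 40, left associativity).
Local Notation "I ~ J" := (ideal_equiv I J) (at level 70).
Variables (gT : finGroupType) (f : gT -> set K).
Hypothesis f_ideal : forall x, nonzero_ideal (f x).
Hypothesis f1 : f 1%g ~ O.
Hypothesis fM : forall x y, f (x * y)%g ~ f x ** f y.
Hypothesis f_surj : forall I, nonzero_ideal I -> exists x, I ~ f x.

Let ker := [set x : gT | `[< f x ~ O >]]%SET.

Let kerP x : reflect (f x ~ O) (x \in ker).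
Proof. by rewrite inE; apply: asboolP. Qed.

Let ker_group_set : group_set ker.
Proof.
apply/group_setP; split=> [|x y /kerP ex /kerP ey]; apply/kerP => //.
rewrite fM ex ey ideal_prod1; first by reflexivity.
exact: nonzero_ideal_O.
Qed.

Let H := group ker_group_set.

Let f_equivE x y : f x ~ f y <-> (H :* x)%g = (H :* y)%g.
Proof.
rewrite (rwP rcoset_eqP) mem_rcoset; split=> [e|/kerP e].
  by apply/kerP; rewrite fM e -fM mulgV.
have := fM (x * y^-1)%g y; rewrite mulgKV => ->.
by rewrite e ideal_prod1; first by reflexivity.
Qed.

Let ideal_class_eq (I J : set K) : nonzero_ideal I -> nonzero_ideal J ->
  ideal_class I = ideal_class J <-> I ~ J.
Proof.
move=> hI hJ; split=> [e|e].
  have : ideal_class J J by split=> //; reflexivity.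
  by rewrite -e => -[].
apply/seteqP; split=> L [hL eL]; split=> //; first by rewrite -e.
by rewrite e.
Qed.

(** A finite group of ideals that meets every ideal class and is compatible
    with products maps onto the class group: the fibres of the map to classes
    are the cosets of its kernel, so that Lagrange's theorem applies. *)
Lemma class_number_dvd_card : (class_number K %| #|gT|)%N.
Proof.
pose R := rcosets H [set: gT]%SET.
pose g (A : {set gT}) := ideal_class (f (repr A)).
pose X := [fset A in R]%fset.
have reprR A : A \in R -> A = (H :* repr A)%g.
  by case/rcosetsP => x _ ->; rewrite rcoset_repr.
have g_inj : {in [set` X] &, injective g}.
  move=> A B; rewrite !inE /= !inE => RA RB.
  move=> /(ideal_class_eq (f_ideal _) (f_ideal _)) /f_equivE e.
  by rewrite (reprR _ RA) (reprR _ RB).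
have classesE : @ideal_classes K = g @` [set` X].
  apply/seteqP; split=> C.
    move=> [I hI <-]; have [x ex] := f_surj hI.
    exists (H :* x)%g; first by rewrite /= inE; apply/rcosetsP; exists x; rewrite ?inE.
    apply/ideal_class_eq => //; rewrite ex; apply/f_equivE.
    by rewrite rcoset_repr.
  by move=> [A _ <-]; exists (f (repr A)).
have -> : class_number K = #|R|.
  rewrite /class_number; apply: card_fset_set; rewrite classesE.
  rewrite (card_eql (inj_card_eq g_inj)); apply/card_eq_fsetP.
  exact: card_finset.
by rewrite -cardsT; apply: dvdn_indexg.
Qed.
End ClassCount.

(** * The integers of a quadratic field *)

Section QuadraticIntegers.
Local Open Scope classical_set_scope.
Variables (K : fieldExtType rat) (d : nat) (s : K).
Hypothesis d_mod4 : d = 2 %[mod 4].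
Hypothesis d_sqfree : squarefree d.
Hypothesis s_sqr : s ^+ 2 = d%:R.
Hypothesis K_gen : <<1; s>>%VS = fullv.
Local Notation O := (@integer_ring K).
Local Notation Q := (in_alg K).

Lemma sqr_neq_twice_odd (a b : int) : a ^+ 2 = d%:Z * b ^+ 2 -> b = 0.
Proof.
move=> e; apply/eqP; apply: contraPT isT => b0 _.
have eN : (`|a| ^ 2 = d * `|b| ^ 2)%N by rewrite -!abszX -[d]/`|d%:Z|%N -abszM e.
have [m em om] : exists2 m, d = (2 * m)%N & odd m.
  by exists (d %/ 2)%N; lia.
have b1 : (0 < `|b|)%N by rewrite absz_gt0.
have := congr1 (logn 2) eN; rewrite em lognM ?expn_gt0 ?b1 //; last by lia.
rewrite lognM //; last by lia.
rewrite (@logn_coprime 2 m) ?coprime2n //.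
have -> : logn 2 2 = 1%N by [].
rewrite !lognX; lia.
Qed.

Lemma rat_sqr_neq (r : rat) : r ^+ 2 != d%:R.
Proof.
apply/eqP => e; have := denq_neq0 r; apply/negP; rewrite negbK; apply/eqP.
apply: (@sqr_neq_twice_odd (numq r)); apply: (@intr_inj rat).
have dr : (denq r)%:~R != 0 :> rat by rewrite intr_eq0 denq_neq0.
rewrite !expr2 !intrM -pmulrn -e.
have -> : (numq r)%:~R = r * (denq r)%:~R by rewrite -{2}(divq_num_den r) divfK.
by ring.
Qed.

Lemma coord_free (a b : rat) : Q a + Q b * s = 0 -> a = 0 /\ b = 0.
Proof.
move=> e; have [b0|b0] := eqVneq b 0.
  split=> //; apply: (fmorph_inj Q); move: e.
  by rewrite b0 !rmorph0 mul0r addr0.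
have := rat_sqr_neq (- a / b); case/eqP; apply: (fmorph_inj Q).
rewrite rmorph_nat -s_sqr rmorphXn fmorph_div rmorphN; congr (_ ^+ 2).
have b0' : Q b != 0 by rewrite fmorph_eq0.
apply: (mulIf b0'); rewrite divfK // mulrC.
by apply/eqP; rewrite eq_sym -subr_eq0 opprK addrC e.
Qed.

Lemma coord_exists x : exists a b : rat, x = Q a + Q b * s.
Proof.
have : x \in <<1; s>>%VS by rewrite K_gen memvf.
case/Fadjoin_polyP => p p1 ->; rewrite horner_coef.
elim/big_ind: _ => [|x1 x2 [a1 [b1 ->]] [a2 [b2 ->]]|i _].
- by exists 0, 0; rewrite !rmorph0; ring.
- by exists (a1 + a2), (b1 + b2); rewrite !rmorphD; ring.
have /vlineP [c ->] := polyOverP p1 i.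
rewrite -(odd_double_half i) exprD -mul2n exprM s_sqr.
rewrite -[c *: 1]/(Q c); case: (odd i).
  exists 0, (c * d%:R ^+ i./2).
  by rewrite rmorphM rmorphXn rmorph_nat rmorph0 expr1; ring.
exists (c * d%:R ^+ i./2), 0.
by rewrite rmorphM rmorphXn rmorph_nat rmorph0 expr0; ring.
Qed.

(** By Gauss's lemma the factor is a rational multiple of an integer polynomial
    whose cofactor is integral; both being monic, the multiple is a unit of the
    integers. *)
Lemma monic_dvd_int (p : {poly int}) (q : {poly rat}) (i : nat) :
  p \is monic -> q \is monic -> q %| map_poly intr p ->
  exists n : int, q`_i = n%:~R.
Proof.
move=> pm qm /dvdpP_rat_int [q1 [c c0 eq] [r er]].
have u1 : lead_coef q1 * lead_coef r = 1 by rewrite -lead_coefM -er (monicP pm).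
have lq : lead_coef (map_poly intr q1 : {poly rat}) = (lead_coef q1)%:~R.
  by rewrite lead_coef_map_inj //; apply: intr_inj.
have : c * (lead_coef q1)%:~R = 1.
  by rewrite -lq -lead_coefZ -eq (monicP qm).
have lq2 : lead_coef q1 * lead_coef q1 = 1.
  have /eqP := congr1 absz u1; rewrite abszM muln_eq1 => /andP [/eqP a1 _].
  by move: (lead_coef q1) a1 => z; nia.
move=> cl; exists (lead_coef q1 * q1`_i); rewrite eq coefZ coef_map /= intrM.
have e1 : (lead_coef q1 * lead_coef q1)%:~R = 1 :> rat by rewrite lq2.
by congr (_ * _); rewrite -[LHS]mulr1 -[X in c * X]e1 intrM mulrA cl mul1r.
Qed.

Lemma rat_int_of_mul_sqr (r : rat) (n : int) :
  d%:R * r ^+ 2 = n%:~R -> exists m : int, r = m%:~R.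
Proof.
move=> e; exists (numq r).
suff d1 : denq r = 1 by rewrite -{1}(divq_num_den r) d1 divr1.
have dr : (denq r)%:~R != 0 :> rat by rewrite intr_eq0 denq_neq0.
have e1 : d%:Z * numq r ^+ 2 = n * denq r ^+ 2.
  apply: (@intr_inj rat); rewrite !expr2 !intrM -e.
  have -> : (numq r)%:~R = r * (denq r)%:~R by rewrite -{2}(divq_num_den r) divfK.
  by rewrite -pmulrn; ring.
have e2 : (d * `|numq r| ^ 2 = `|n| * `|denq r| ^ 2)%N.
  by rewrite -!abszX -[d]/`|d%:Z|%N -!abszM e1.
have : (`|denq r| ^ 2 %| d * `|numq r| ^ 2)%N by rewrite e2 dvdn_mull.
rewrite Gauss_dvdl; last first.
  by rewrite coprimeXl // coprimeXr // coprime_sym coprime_num_den.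
by move/d_sqfree => d1; have := denq_gt0 r; lia.
Qed.

(** Integrality of [a + b s] makes its trace [2 a] and its norm integers, and
    then [2 b] too, as [d] is squarefree.  For odd [2 a] the integer
    [(2 a) ^ 2 - d (2 b) ^ 2] would be odd, and for even [2 a] and odd [2 b] it
    would be 2 modulo 4, whereas it is 4 times the norm. *)
Lemma coord_int (a b : rat) : O (Q a + Q b * s) ->
  exists m n : int, a = m%:~R /\ b = n%:~R.
Proof.
move=> [p pm rx]; pose P := map_poly intr p : {poly rat}.
set x := _ + _ in rx.
have PQ : map_poly Q P = map_poly intr p.
  by rewrite -map_poly_comp; apply: eq_map_poly => z; exact: rmorph_int.
have {}rx : (map_poly Q P).[x] = 0 by rewrite PQ; apply/eqP.
have [b0|b0] := eqVneq b 0.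
  have ex : x = Q a by rewrite /x b0 rmorph0 mul0r addr0.
  have : 'X - a%:P %| P.
    rewrite dvdp_XsubCl /root; apply/eqP; apply: (fmorph_inj Q).
    by rewrite rmorph0 -[LHS]horner_map -[X in _.[X]]ex.
  case/(monic_dvd_int 0 pm (monicXsubC _)) => n; rewrite coefB coefX coefC sub0r => e.
  by exists (- n), 0; split=> //; rewrite -[LHS]opprK e -rmorphN.
(* The minimal polynomial of [x]. *)
pose q : {poly rat} := Poly [:: a ^+ 2 - d%:R * b ^+ 2; - (2 * a); 1].
have qE : polyseq q = [:: a ^+ 2 - d%:R * b ^+ 2; - (2 * a); 1].
  by rewrite (@PolyK _ 0) //= oner_neq0.
have qm : q \is monic by rewrite monicE lead_coefE qE.
have qx : (map_poly Q q).[x] = 0.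
  rewrite map_polyE qE horner_Poly /=.
  rewrite -![_ *: 1]/(Q _) /x.
  by ring: s_sqr.
have qP : q %| P.
  pose r := P %% q; rewrite /dvdp -/r.
  have rsz : (size (map_poly Q r) <= 2)%N.
    rewrite size_map_poly -ltnS.
    have -> : 3%N = size q by rewrite qE.
    by rewrite ltn_modp -size_poly_eq0 qE.
  have : (map_poly Q r).[x] = 0.
    by move: rx; rewrite {1}(divp_eq P q) rmorphD rmorphM !hornerE qx mulr0 add0r.
  rewrite (horner_coef_wide _ rsz) !big_ord_recl big_ord0 !coef_map => e.
  have : Q (r`_0 + r`_1 * a) + Q (r`_1 * b) * s = 0.
    rewrite -[RHS]e expr0 [_ ^+ lift _ _]expr1 /x.
    by rewrite rmorphD !rmorphM -[nat_of_ord (lift _ _)]/1%N -[nat_of_ord _]/0%N; ring.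
  case/coord_free => e0 /eqP; rewrite mulf_eq0 (negPf b0) orbF => /eqP r1.
  have r0 : r`_0 = 0 by rewrite -[RHS]e0 r1 mul0r addr0.
  rewrite size_map_poly in rsz.
  apply/eqP/polyP => i; rewrite coef0.
  by case: i => [|[|i]] //; rewrite nth_default //; apply: leq_trans rsz _.
have [t et] := monic_dvd_int 1 pm qm qP.
have [n en] := monic_dvd_int 0 pm qm qP.
move: et en; rewrite qE /= => et en.
have [u eu] : exists u : int, 2 * b = u%:~R.
  apply: (@rat_int_of_mul_sqr _ (t ^+ 2 - 4 * n)).
  by rewrite rmorphB rmorphXn rmorphM /= -et -en; ring.
have e : t ^+ 2 - d%:Z * u ^+ 2 = 4 * n.
  apply: (@intr_inj rat).
  by rewrite rmorphB rmorphXn rmorphM rmorphXn rmorphM /= -et -en -eu -pmulrn; ring.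
have [m em] : exists m : int, d%:Z = 4 * m + 2 by exists (d %/ 4)%N%:Z; lia.
have [t' [?|?]] : exists t' : int, t = 2 * t' \/ t = 2 * t' + 1.
- by exists (t %/ 2)%Z; lia.
- have [u' [?|?]] : exists u' : int, u = 2 * u' \/ u = 2 * u' + 1.
  + by exists (u %/ 2)%Z; lia.
  + exists (- t'), u'; subst t u; split.
      by apply: (@mulfI _ 2) => //; rewrite -[LHS]opprK et; ring.
    by apply: (@mulfI _ 2) => //; rewrite eu; ring.
  + by subst t u; rewrite em in e; lia.
- by subst t; rewrite em in e; lia.
Qed.

Definition zsqrt (a b : int) : K := a%:~R + b%:~R * s.

Lemma integer_ringP x : O x <-> exists a b : int, x = zsqrt a b.
Proof.
split=> [Ox|[a [b ->]]].
  have [a [b ex]] := coord_exists x; rewrite ex in Ox *.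
  have [m [n [-> ->]]] := coord_int Ox.
  by exists m, n; rewrite /zsqrt !rmorph_int.
apply: integer_ringD; first exact: integer_ring_int.
apply: integer_ringM; first exact: integer_ring_int.
exists ('X^2 - d%:R%:P); first by rewrite monicXnsubC.
rewrite rmorphB rmorphXn /= map_polyX map_polyC /root !hornerE s_sqr.
by rewrite -[X in _ - X]/(d%:R%:~R) natz -pmulrn subrr.
Qed.

Lemma zs_inj a b a' b' : zsqrt a b = zsqrt a' b' -> a = a' /\ b = b'.
Proof.
move=> e; have : Q (a - a')%:~R + Q (b - b')%:~R * s = 0.
  rewrite !rmorph_int !intrB -[RHS](subrr (zsqrt a b)) {2}e /zsqrt.
  by ring.
case/coord_free => /eqP; rewrite intr_eq0 subr_eq0 => /eqP -> /eqP.
by rewrite intr_eq0 subr_eq0 => /eqP ->.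
Qed.


End QuadraticIntegers.

(** * Ideals as lattices *)

Lemma int_ideal_gen (S : int -> Prop) :
  (forall a b m n, S m -> S n -> S (a * m + b * n)) ->
  (exists2 n, S n & n != 0) ->
  exists g, [/\ 0 < g, S g & forall n, S n -> exists k, n = k * g].
Proof.
move=> Slin [n0 Sn0 n0N].
have exP : exists n : nat, (0 < n)%N && `[< S n%:Z >].
  exists `|n0|%N; rewrite absz_gt0 n0N; apply/asboolP.
  have -> : `|n0|%N%:Z = sgz n0 * n0 + 0 * n0 by rewrite abszEsg; ring.
  exact: Slin.
case: (ex_minnP exP) => g /andP [g0 /asboolP Sg] gmin.
exists g%:Z; split=> // n Sn; exists (n %/ g%:Z)%Z.
have Sr : S (n %% g%:Z)%Z.
  have -> : (n %% g%:Z)%Z = 1 * n + (- (n %/ g%:Z)%Z) * g%:Z.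
    by rewrite {2}(divz_eq n g%:Z); ring.
  exact: Slin.
have r0 : 0 <= (n %% g%:Z)%Z by rewrite modz_ge0 //; lia.
have rg : (n %% g%:Z)%Z < g%:Z by rewrite ltz_pmod //; lia.
have [rn|rn] := eqVneq (n %% g%:Z)%Z 0; first by rewrite {1}(divz_eq n g%:Z) rn addr0.
have /gmin : ((0 < `|(n %% g%:Z)%Z|) && `[< S `|(n %% g%:Z)%Z|%:Z >])%N.
  by rewrite absz_gt0 rn /=; apply/asboolP; rewrite gez0_abs.
by lia.
Qed.

Section QuadraticLattices.
Local Open Scope classical_set_scope.
Variables (K : fieldExtType rat) (d : nat) (s : K).
Hypothesis d_mod4 : d = 2 %[mod 4].
Hypothesis d_sqfree : squarefree d.
Hypothesis s_sqr : s ^+ 2 = d%:R.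
Hypothesis K_gen : <<1; s>>%VS = fullv.
Local Notation O := (@integer_ring K).
Local Notation zs := (zsqrt s).
Local Notation "I ** J" := (ideal_prod I J) (at level 40, left associativity).
Local Notation "I ~ J" := (ideal_equiv I J) (at level 70).

Let OP x := integer_ringP d_mod4 d_sqfree s_sqr K_gen x.
Let zsI := zs_inj d_mod4 s_sqr.

Lemma zsD a b a' b' : zs a b + zs a' b' = zs (a + a') (b + b').
Proof. by rewrite /zsqrt !intrD; ring. Qed.

Lemma zsM a b a' b' :
  zs a b * zs a' b' = zs (a * a' + d%:Z * (b * b')) (a * b' + b * a').
Proof. by rewrite /zsqrt !intrD !intrM -pmulrn; ring: s_sqr. Qed.

Lemma O_zs a b : O (zs a b).
Proof. by apply/OP; exists a, b. Qed.

Lemma zs_eq0 a b : zs a b = 0 -> a = 0 /\ b = 0.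
Proof. by move=> e; apply: zsI; rewrite e /zsqrt; ring. Qed.

Lemma zs_int (n : int) : n%:~R = zs n 0.
Proof. by rewrite /zsqrt mul0r addr0. Qed.

(** The lattice spanned by [N] and [x + s]; when [N] divides [x ^ 2 - d] it is
    a primitive ideal of norm [N], and every primitive ideal has this form. *)
Definition latt (N x : int) : set K :=
  [set z | exists a b : int, z = zs (N * a + x * b) b].

Lemma lattN N x : latt (- N) x = latt N x.
Proof.
have sub M : latt (- M) x `<=` latt M x.
  by move=> z [a [b ->]]; exists (- a), b; congr (zsqrt _ _ _); ring.
by apply/seteqP; split=> //; rewrite -{1}(opprK N).
Qed.

Lemma latt_shift N x k : latt N (x + k * N) = latt N x.
Proof.
apply/seteqP; split=> z [a [b ->]].
  by exists (a + k * b), b; congr (zsqrt _ _ _); ring.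
by exists (a - k * b), b; congr (zsqrt _ _ _); ring.
Qed.

Lemma latt1 x : latt 1 x = O.
Proof.
apply/seteqP; split=> z; first by move=> [a [b ->]]; apply: O_zs.
by move=> /OP [a [b ->]]; exists (a - x * b), b; congr (zsqrt _ _ _); ring.
Qed.

Lemma latt_norm N x : latt N x N%:~R.
Proof. by exists 1, 0; rewrite zs_int; congr (zsqrt _ _ _); ring. Qed.

Lemma latt_gen N x : latt N x (zs x 1).
Proof. by exists 0, 1; congr (zsqrt _ _ _); ring. Qed.

Lemma nonzero_ideal_latt (N x e : int) :
  N != 0 -> d%:Z = x ^+ 2 - N * e -> nonzero_ideal (latt N x).
Proof.
move=> N0 eN; split.
- by move=> z [a [b ->]]; apply: O_zs.
- by exists 0, 0; rewrite -[LHS]/(0%:~R) zs_int; congr (zsqrt _ _ _); ring.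
- move=> y z [a [b ->]] [a' [b' ->]]; exists (a + a'), (b + b').
  by rewrite zsD; congr (zsqrt _ _ _); ring.
- move=> y z /OP [u [v ->]] [a [b ->]]; rewrite zsM.
  exists (u * a - x * v * a - v * b * e), (u * b + v * (N * a + x * b)).
  by congr (zsqrt _ _ _); rewrite ?eN; ring.
- exists N%:~R; first exact: latt_norm.
  by rewrite zs_int; apply/eqP => /zs_eq0 [/eqP]; rewrite (negPf N0).
Qed.

(** Dirichlet's composition, valid as soon as [N], [M] and [2 x] are coprime:
    this is what makes [x + s] itself an element of the product. *)
Lemma latt_prod (N M x e u v w : int) :
  N != 0 -> M != 0 -> d%:Z = x ^+ 2 - N * M * e -> u * N + v * M + w * (2 * x) = 1 ->
  latt N x ** latt M x = latt (N * M) x.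
Proof.
move=> N0 M0 ee bez.
have hN : nonzero_ideal (latt N x).
  by apply: (@nonzero_ideal_latt N x (M * e)) => //; rewrite ee; ring.
have hM : nonzero_ideal (latt M x).
  by apply: (@nonzero_ideal_latt M x (N * e)) => //; rewrite ee; ring.
have bez1 : _%:~R = 1%:~R :> K := congr1 intr bez.
have hP := nonzero_ideal_prod hN hM.
apply/seteqP; split.
  apply: ideal_prod_sub.
    move=> _ _ [a [b ->]] [a' [b' ->]]; rewrite zsM.
    exists (a * a' - b * b' * e), (N * a * b' + M * a' * b + b * b' * (2 * x)).
    by congr (zsqrt _ _ _); rewrite ?ee; ring.
  move=> _ _ [a [b ->]] [a' [b' ->]]; exists (a + a'), (b + b').
  by rewrite zsD; congr (zsqrt _ _ _); ring.
have PN : (latt N x ** latt M x) (N * M)%:~R.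
  by rewrite intrM; apply: ideal_prod_gen; apply: latt_norm.
have Px : (latt N x ** latt M x) (zs x 1).
  have -> : zs x 1 = u%:~R * (N%:~R * zs x 1) + v%:~R * (zs x 1 * M%:~R)
      + w%:~R * (zs x 1 * zs x 1) + (w * e)%:~R * (N * M)%:~R.
    rewrite -[LHS]mul1r -[X in X * _ = _]/(1%:~R) -bez1 !zs_int !zsM !zsD.
    by congr (zsqrt _ _ _); rewrite ?ee; ring.
  apply: (idealD hP); [apply: (idealD hP); [apply: (idealD hP)|]|];
    apply: ideal_int => //.
  - by apply: ideal_prod_gen; [exact: latt_norm|exact: latt_gen].
  - by apply: ideal_prod_gen; [exact: latt_gen|exact: latt_norm].
  - by apply: ideal_prod_gen; exact: latt_gen.
move=> z [a [b ->]].
have -> : zs (N * M * a + x * b) b = a%:~R * (N * M)%:~R + b%:~R * zs x 1.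
  by rewrite !zs_int !zsM !zsD; congr (zsqrt _ _ _); ring.
by apply: (idealD hP); apply: ideal_int.
Qed.

(** The product with the conjugate lattice is [N] times the ideal generated by
    [N], [2 x] and the cofactor [e] of [N] in the norm of [x + s], so that it
    is principal when these three numbers are coprime. *)
Lemma latt_conj (N x e u v w : int) :
  N != 0 -> d%:Z = x ^+ 2 - N * e -> u * N + v * (2 * x) + w * e = 1 ->
  latt N x ** latt N (- x) ~ O.
Proof.
move=> N0 ee bez.
have hN : nonzero_ideal (latt N x) by apply: (@nonzero_ideal_latt N x e).
have hN' : nonzero_ideal (latt N (- x)).
  by apply: (@nonzero_ideal_latt N (- x) e) => //; rewrite sqrrN.
have bez1 : _%:~R = 1%:~R :> K := congr1 intr bez.
have hP := nonzero_ideal_prod hN hN'.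
have PN : (latt N x ** latt N (- x)) N%:~R.
  have -> : N%:~R = u%:~R * (N%:~R * N%:~R) + v%:~R * (zs x 1 * N%:~R)
     + (- v)%:~R * (N%:~R * zs (- x) 1) + (- w)%:~R * (zs x 1 * zs (- x) 1).
    rewrite -[LHS]mul1r -[X in X * _ = _]/(1%:~R) -bez1 !zs_int !zsM !zsD.
    by congr (zsqrt _ _ _); rewrite ?ee; ring.
  apply: (idealD hP); [apply: (idealD hP); [apply: (idealD hP)|]|];
    apply: ideal_int => //.
  - by apply: ideal_prod_gen; exact: latt_norm.
  - by apply: ideal_prod_gen; [exact: latt_gen|exact: latt_norm].
  - by apply: ideal_prod_gen; [exact: latt_norm|exact: latt_gen].
  - by apply: ideal_prod_gen; exact: latt_gen.
exists 1, N%:~R; split; first exact: integer_ring1.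
- exact: integer_ring_int.
- exact: oner_neq0.
- by rewrite zs_int; apply/eqP => /zs_eq0 [/eqP]; rewrite (negPf N0).
apply/seteqP; split=> _ [z Hz <-]; last first.
  exists (z * N%:~R); last by rewrite mul1r mulrC.
  exact: (idealMl hP).
rewrite mul1r; move: z Hz; apply: ideal_prod_sub.
  move=> _ _ [a [b ->]] [a' [b' ->]].
  exists (zs (N * a * a' + a * (- x) * b' + a' * x * b - b * b' * e) (a * b' + a' * b)).
    exact: O_zs.
  by rewrite zs_int !zsM; congr (zsqrt _ _ _); rewrite ?ee; ring.
move=> _ _ [a Oa <-] [b Ob <-]; exists (a + b); last by rewrite mulrDr.
exact: integer_ringD.
Qed.

(** Multiplication by [x - s], an element of norm [N * N'], carries one lattice
    onto a multiple of the other. *)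
Lemma latt_flip (N N' x : int) : N != 0 -> d%:Z = x ^+ 2 - N * N' ->
  latt N x ~ latt N' (- x).
Proof.
move=> N0 ee; exists (zs x (- 1)), N%:~R.
split; [exact: O_zs|exact: integer_ring_int| | |].
- by apply/eqP => /zs_eq0 [_ /eqP]; rewrite oppr_eq0 oner_eq0.
- by rewrite zs_int; apply/eqP => /zs_eq0 [/eqP]; rewrite (negPf N0).
apply/seteqP; split=> _ [_ [a [b ->]] <-].
  exists (zs (N' * b + (- x) * (- a)) (- a)); first by exists b, (- a).
  by rewrite zs_int !zsM; congr (zsqrt _ _ _); rewrite ?ee; ring.
exists (zs (N * (- b) + x * a) a); first by exists (- b), a.
by rewrite zs_int !zsM; congr (zsqrt _ _ _); rewrite ?ee; ring.
Qed.

End QuadraticLattices.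

(** * Reduction of ideals *)

Section Reduction.
Local Open Scope classical_set_scope.
Variables (K : fieldExtType rat) (d : nat) (s : K).
Hypothesis d_mod4 : d = 2 %[mod 4].
Hypothesis d_sqfree : squarefree d.
Hypothesis s_sqr : s ^+ 2 = d%:R.
Hypothesis K_gen : <<1; s>>%VS = fullv.
Local Notation O := (@integer_ring K).
Local Notation zs := (zsqrt s).
Local Notation latt := (latt s).
Local Notation "I ** J" := (ideal_prod I J) (at level 40, left associativity).
Local Notation "I ~ J" := (ideal_equiv I J) (at level 70).

Let OP x := integer_ringP d_mod4 d_sqfree s_sqr K_gen x.

(** If [c] generates the group of [s]-coordinates of [I] and [n] its
    intersection with the integers, then [c] divides everything in sight,
    because [I] is stable under multiplication by [s]; dividing [I] by [c]
    leaves a lattice. *)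
Lemma ideal_equiv_latt (I : set K) : nonzero_ideal I ->
  exists N x e : int, [/\ 0 < N, d%:Z = x ^+ 2 - N * e & I ~ latt N x].
Proof.
move=> hI; have [z Iz z0] := ideal_neq0 hI.
have ID u v a b : I (zs u v) -> I (zs a b) -> I (zs (u + a) (v + b)).
  by move=> h1 h2; rewrite -zsD; apply: (idealD hI).
have IZ n u v : I (zs u v) -> I (zs (n * u) (n * v)).
  move=> h; have -> : zs (n * u) (n * v) = n%:~R * zs u v.
    by rewrite (zs_int s) (zsM s_sqr); congr (zsqrt _ _ _); ring.
  exact: ideal_int.
have Is p q u v : I (zs u v) -> I (zs (p * u + d%:Z * (q * v)) (p * v + q * u)).
  move=> h; rewrite -(zsM s_sqr); apply: (idealMl hI) => //.
  exact: (O_zs d_mod4).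
have [n [n0 Sn nmin]] : exists g, [/\ 0 < g, I (zs g 0) &
    forall n, I (zs n 0) -> exists k, n = k * g].
  apply: (@int_ideal_gen (fun n => I (zs n 0))) => [a b m n hm hn|].
    by have := ID _ _ _ _ (IZ a _ _ hm) (IZ b _ _ hn); rewrite !mulr0 addr0.
  have /OP [a [b ez]] := ideal_sub hI Iz; rewrite ez in Iz z0.
  exists (a ^+ 2 - d%:Z * b ^+ 2).
    have -> : zs (a ^+ 2 - d%:Z * b ^+ 2) 0 =
        zs (a * a + d%:Z * (- b * b)) (a * b + (- b) * a).
      by congr (zsqrt _ _ _); ring.
    exact: Is.
  apply: contraNneq z0 => /eqP; rewrite subr_eq0 => /eqP e.
  have b0 := sqr_neq_twice_odd d_mod4 e.
  move: e; rewrite b0 expr0n mulr0 => /eqP; rewrite sqrf_eq0 => /eqP ->.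
  by rewrite -(zs_int s).
have [c [c0 [b Sc] cmin]] : exists g, [/\ 0 < g, exists a, I (zs a g) &
    forall n, (exists a, I (zs a n)) -> exists k, n = k * g].
  apply: (@int_ideal_gen (fun n => exists a, I (zs a n))) => [a b m k [u hm] [v hk]|].
    by exists (a * u + b * v); apply: ID; apply: IZ.
  exists n; last by rewrite gt_eqF.
  by exists 0; have := Is 0 1 _ _ Sn; rewrite !mul0r !mul1r !add0r mulr0.
have [N eN] : exists k, n = k * c.
  by apply: cmin; exists 0; have := Is 0 1 _ _ Sn; rewrite !mul0r !mul1r !add0r mulr0.
have [x ex] : exists k, b = k * c.
  apply: cmin; exists (d%:Z * c).
  by have := Is 0 1 _ _ Sc; rewrite !mul0r !mul1r !add0r.
have [e ee] : exists k, c * (x ^+ 2 - d%:Z) = k * n.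
  apply: nmin; have := Is x (- 1) _ _ Sc.
  by congr (I (zsqrt _ _ _)); rewrite ex; ring.
exists N, x, e; split.
- by rewrite eN pmulr_lgt0 in n0.
- apply: (@mulfI _ c); first by rewrite gt_eqF.
  have -> : c * (x ^+ 2 - N * e) = c * x ^+ 2 - e * n by rewrite eN; ring.
  by rewrite -ee; ring.
exists 1, c%:~R.
split; [exact: integer_ring1|exact: integer_ring_int|exact: oner_neq0| |].
  by rewrite (zs_int s); apply/eqP => /(zs_eq0 d_mod4 s_sqr) [/eqP]; rewrite gt_eqF.
apply/seteqP; split=> [_ [y Iy <-]|_ [_ [p [q ->]] <-]].
  rewrite mul1r; have /OP [p [q ey]] := ideal_sub hI Iy; rewrite ey in Iy *.
  have [k ek] : exists k, q = k * c by apply: cmin; exists p.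
  have [l el] : exists l, p - k * b = l * n.
    apply: nmin; have := ID _ _ _ _ Iy (IZ (- k) _ _ Sc).
    by congr (I (zsqrt _ _ _)); rewrite ?ek; ring.
  exists (zs (N * l + x * k) k); first by exists l, k.
  rewrite (zs_int s) (zsM s_sqr); congr (zsqrt _ _ _); last by rewrite ek; ring.
  have -> : p = l * n + k * b by rewrite -el; ring.
  by rewrite ex eN; ring.
exists (zs (p * n + q * b) (p * 0 + q * c)); first by apply: ID; apply: IZ.
by rewrite (zs_int s) mul1r (zsM s_sqr); congr (zsqrt _ _ _); rewrite ?ex ?eN; ring.
Qed.

(** Replacing a lattice of norm [N], with [2 |x| <= N], by its neighbour of norm
    [|x ^ 2 - d| / N] makes the norm smaller until [N ^ 2 <= d]. *)
Lemma latt_reduce (N x e : int) : 0 < N -> d%:Z = x ^+ 2 - N * e ->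
  exists M y f : int, [/\ 0 < M, M ^+ 2 <= d%:Z, d%:Z = y ^+ 2 - M * f &
    latt N x ~ latt M y].
Proof.
move: {2}`|N|%N (leqnn `|N|%N) => n; elim: n N x e => [|n IH] N x e; first by lia.
move=> Nn N0 ee.
(* The residue of [x] of least absolute value. *)
have [y [k [ey yN]]] : exists y k : int, y = x + k * N /\ `|2 * y| <= N.
  have e1 := divz_eq x N; have r0 := modz_ge0 x (lt0r_neq0 N0).
  have r1 := ltz_pmod x N0.
  have [h|h] := lerP (2 * (x %% N)%Z) N.
    exists (x %% N)%Z, (- (x %/ N)%Z); split; last by lia.
    by rewrite {2}e1; ring.
  exists ((x %% N)%Z - N), (- (x %/ N)%Z - 1); split; last by lia.
  by rewrite {2}e1; ring.
rewrite -(latt_shift s N x k) -ey.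
have [f ef] : exists f, d%:Z = y ^+ 2 - N * f.
  by exists (e + k * (2 * x + k * N)); rewrite ey ee; ring.
have f0 : f != 0.
  apply/eqP => f0; move: ef; rewrite f0 mulr0 subr0 => ef.
  have : 1 = 0 :> int
    by apply: (sqr_neq_twice_odd d_mod4 (a := y)); rewrite -ef expr1n mulr1.
  by [].
have [lef|ltf] := lerP N `|f|; last first.
  have flip : latt N y ~ latt `|f| (- y).
    have -> : latt `|f| (- y) = latt f (- y) by case: (ger0P f) => _; rewrite ?lattN.
    by apply: (latt_flip d_mod4 _ _ _ _) => //; rewrite gt_eqF.
  have [|||M [z [g [? ? ? eg]]]] := IH `|f| (- y) (sgz f * N).
  - by lia.
  - by rewrite normr_gt0.
  - by rewrite sqrrN ef mulrA (mulrC `|f|) -intEsg (mulrC f).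
  by exists M, z, g; split=> //; rewrite flip.
exists N, y, f; split=> //; last by reflexivity.
by case: (ltrP f 0) => ?; nia.
Qed.

Lemma reduced_latt (I : set K) : nonzero_ideal I ->
  exists M y f : int, [/\ 0 < M, M ^+ 2 <= d%:Z, d%:Z = y ^+ 2 - M * f & I ~ latt M y].
Proof.
move=> /ideal_equiv_latt [N [x [e [N0 ee eI]]]].
have [M [y [f [? ? ? el]]]] := latt_reduce N0 ee.
by exists M, y, f; split=> //; rewrite eI.
Qed.

End Reduction.

(** * Values of d - x ^ 2 with few prime factors *)

Section EvenSquares.
Local Open Scope nat_scope.
Variable d : nat.
Hypothesis d_mod4 : d = 2 %[mod 4].
Hypothesis d_sqfree : squarefree d.
Hypothesis hM : M_even' d <= 2.

(** For even [x] the number [d - x ^ 2] is twice an odd number, so having at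
    most two prime factors leaves room for a single odd one. *)
Lemma even_square_complement x : ~~ odd x -> 1 < x -> x ^ 2 <= d ->
  exists p k, [/\ prime p, odd p & d = x ^ 2 + 2 * p ^ k].
Proof.
move=> ex x1 xd.
have om : omega (d - x ^ 2) <= 2.
  apply: leq_trans hM; apply: (@leq_bigmax_seq _ _ _ (fun x => omega (d - x ^ 2))).
    rewrite mem_index_iota x1 ltnS.
    by apply: leq_trans xd; rewrite -{1}(expn1 x) leq_exp2l.
  by rewrite ex xd.
have [n en on] : exists2 n, d - x ^ 2 = 2 * n & odd n.
  have [y ey] : exists y, x = 2 * y by exists x./2; lia.
  exists ((d - x ^ 2) %/ 2); rewrite ey in xd *; first by rewrite expnMn in xd *; lia.
  by rewrite expnMn in xd *; lia.
have n0 : 0 < n by case: n on {en}.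
have dE : d = x ^ 2 + 2 * n by lia.
have sz : size (primes n) <= 1.
  rewrite -ltnS; apply: leq_trans om; rewrite /omega en.
  apply: (@uniq_leq_size _ (2 :: primes n)) => [|p].
    by rewrite /= primes_uniq mem_primes dvdn2 on n0.
  rewrite inE primesM // => /orP [/eqP ->|->]; last by rewrite orbT.
  by rewrite primes_prime // inE eqxx.
have := prod_prime_decomp n0; rewrite prime_decompE big_map.
case e : (primes n) sz => [|p [|]] // _.
  (* Here [d - x ^ 2 = 2], and any odd prime will do. *)
  by rewrite big_nil => n1; exists 3, 0; split; rewrite // dE n1.
have : p \in primes n by rewrite e inE.
rewrite mem_primes big_seq1 => /and3P [pp _ pn] np.
by exists p, (logn p n); split; [|exact: dvdn_odd pn on|rewrite dE {1}np].
Qed.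

Lemma squarefree_prime p : prime p -> ~~ (p ^ 2 %| d).
Proof. by move=> pp; apply/negP => /d_sqfree p1; rewrite p1 in pp. Qed.

Lemma coprime_of_mul_dvd a b : 0 < b -> a * b %| d -> coprime a b.
Proof.
move=> b0 abd; apply/eqP/d_sqfree; apply: dvdn_trans abd.
by rewrite expnS expn1 dvdn_mul ?dvdn_gcdl ?dvdn_gcdr.
Qed.

Definition one_or_prime q := q = 1 \/ prime q.

(** If [d] had three odd prime factors, its least one [p] would satisfy
    [(2 p) ^ 2 <= d].  Then [d - (2 p) ^ 2] is twice a power of [p], and it is
    [2 p] because [d] is squarefree; so [d = 2 p (2 p + 1)], which leaves no
    room for two more prime factors larger than [p]. *)
Lemma two_odd_primes : exists q1 q2,
  [/\ d = 2 * (q1 * q2), odd (q1 * q2), one_or_prime q1 & one_or_prime q2].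
Proof.
have [m em om] : exists2 m, d = 2 * m & odd m by exists (d %/ 2); lia.
have [m1|m1] := leqP m 1.
  by exists 1, 1; split; rewrite ?em //; [lia|left|left].
have pp := pdiv_prime m1; set p := pdiv m in pp.
have [c mc] : exists c, m = p * c by exists (m %/ p); rewrite mulnC divnK // pdiv_dvd.
have [c1|c1] := leqP c 1.
  have cE : c = 1 by move: om; rewrite mc; case: c c1 {mc} => [|[|]] //; rewrite !muln0.
  by exists p, c; split; rewrite -?mc //; [right|left].
have pq := pdiv_prime c1; set q := pdiv c in pq.
have [c' cc] : exists c', c = q * c'
  by exists (c %/ q); rewrite mulnC divnK // pdiv_dvd.
have [c'1|c'1] := leqP c' 1.
  have c'E : c' = 1.
    by move: om; rewrite mc cc; case: c' c'1 {cc} => [|[|]] //; rewrite !muln0.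
  rewrite c'E muln1 in cc.
  by exists p, c; split; rewrite -?mc //; right; rewrite // cc.
exfalso.
have [op oq oc] : [/\ odd p, odd q & odd c'].
  by move: om; rewrite mc cc !oddM; case/and3P.
have p_lt_q : p < q.
  rewrite ltn_neqAle pdiv_min_dvd ?prime_gt1 //; last first.
    by rewrite mc cc; apply/dvdnP; exists (p * c'); lia.
  rewrite andbT; apply/eqP => epq.
  have := squarefree_prime pp; rewrite em mc cc -epq => /negP; apply.
  by apply/dvdnP; exists (2 * c'); lia.
have p3 : 2 < p by rewrite odd_prime_gt2.
have c_ge : p.+1 * 3 <= c by rewrite cc leq_mul //; case: c' c'1 oc {cc} => [|[|[|]]].
have hx : 2 * p * (2 * p) <= d.
  have : p * (2 * p) <= p * c by rewrite leq_mul2l; lia.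
  by rewrite em mc; lia.
(* The even square to try is [(2 p) ^ 2]. *)
have [|||r [k [pr or er]]] := @even_square_complement (2 * p).
- by rewrite oddM.
- lia.
- by rewrite expnS expn1.
have e1 : p * c = 2 * p * p + r ^ k by move: er; rewrite em mc expnMn; lia.
have e2 : p %| r ^ k by rewrite -(@dvdn_addr (2 * p * p)) ?dvdn_mull // -e1 dvdn_mulr.
have k0 : 0 < k.
  by case: k e2 {er e1} => //; rewrite expn0 dvdn1 => /eqP p1; rewrite p1 in pp.
have epr : p = r by move: e2; rewrite Euclid_dvdX // dvdn_prime2 // => /andP [/eqP].
have e3 : c = 2 * p + p ^ k.-1.
  have p0 := prime_gt0 pp; apply/eqP; rewrite -(eqn_pmul2l p0).
  by rewrite e1 -epr -{1}(prednK k0) expnS; lia.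
case: (k.-1) e3 => [|j] e3; first by rewrite expn0 in e3; lia.
have := squarefree_prime pp; rewrite em mc e3 [p ^ j.+1]expnS => /negP; apply.
by apply/dvdnP; exists (2 * (2 + p ^ j)); move: (p ^ j) => y; rewrite expnS expn1; lia.
Qed.

Lemma dvd_square_complement p x : prime p -> odd p -> ~~ odd x -> 1 < x ->
  x ^ 2 <= d -> p %| d - x ^ 2 -> exists k, d = x ^ 2 + 2 * p ^ k.+1.
Proof.
move=> pp op ex x1 xd; have [r [k [pr or ->]]] := even_square_complement ex x1 xd.
rewrite addKn Euclid_dvdM // dvdn_prime2 // => /orP [/eqP p2|].
  by rewrite p2 in op.
case: k => [|k]; first by rewrite dvdn1 => /eqP p1; rewrite p1 in pp.
by rewrite Euclid_dvdX // dvdn_prime2 // => /andP [/eqP -> _]; exists k.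
Qed.

(** When [(2 p) ^ 2 <= d] both [x] and [2 p - x] are available, and [p ^ 2] cannot
    divide both complements, because their difference is [4 p (p - x)]. *)
Lemma prime_square_complement p x : prime p -> odd p -> ~~ odd x -> 0 < x < p ->
  p ^ 2 <= d -> p %| d - x ^ 2 ->
  [\/ d = x ^ 2 + 2 * p, d = (2 * p - x) ^ 2 + 2 * p | d = x ^ 2 + 2 * p ^ 2].
Proof.
move=> pp op ex /andP [x0 xp] pd px.
have x1 : 1 < x by case: x x0 ex {xp px} => [|[]].
have xd : x ^ 2 <= d by apply: leq_trans pd; rewrite leq_exp2r // ltnW.
have [k ek] := dvd_square_complement pp op ex x1 xd px.
have [t ep] : exists t, p = x + t by exists (p - x); lia.
have p0 : 0 < p := prime_gt0 pp.
have [le4|gt4] := leqP ((2 * p) ^ 2) d; last first.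
  case: k ek => [|[|k]] ek; [by constructor 1; rewrite ek expn1|by constructor 3|].
  have p3 : 2 < p by rewrite odd_prime_gt2.
  have : p ^ 3 <= p ^ k.+3 by rewrite leq_exp2l // ltnW.
  have : 3 * p ^ 2 <= p ^ 3 by rewrite [p ^ 3]expnS leq_mul2r p3 orbT.
  by move: gt4; rewrite expnMn; lia.
have zd : (2 * p - x) ^ 2 <= d by apply: leq_trans le4; rewrite leq_exp2r //; lia.
have sqE : (2 * p - x) ^ 2 = x ^ 2 + p * (4 * t).
  have -> : 2 * p - x = x + 2 * t by lia.
  by rewrite ep -!mulnn; lia.
have [|||l el] := @dvd_square_complement p (2 * p - x) pp op _ _ zd.
- by rewrite oddB ?oddM //; lia.
- by lia.
- have -> : d - (2 * p - x) ^ 2 = d - x ^ 2 - p * (4 * t) by rewrite sqE subnDA.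
  by rewrite dvdn_subr ?dvdn_mulr //; lia.
case: k ek => [|k] ek; first by constructor 1; rewrite ek expn1.
case: l el => [|l] el; first by constructor 2; rewrite el expn1.
(* Both complements are multiples of [p ^ 2], so that [p] divides [4 (p - x)]. *)
have e1 : p * (2 * p ^ k.+1) = p * (4 * t + 2 * p ^ l.+1).
  by move: el; rewrite sqE {1}ek !(expnS p _.+1); lia.
have /eqP := e1; rewrite eqn_pmul2l // => /eqP e2.
have : p %| 4 * t.
  rewrite -(@dvdn_addl (2 * p ^ l.+1)) -?e2 expnS ?(mulnCA 2) ?dvdn_mulr //.
rewrite (@Gauss_dvdr p 4); last by rewrite -[4]/(2 ^ 2) coprimeXr // coprimen2.
by move/dvdn_leq; clear -ep x0 xp; lia.
Qed.

End EvenSquares.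

(** For such a pair the square of the ideal [(p, x + s)] is equivalent to the
    prime above 2, so that its class may have order 4; every other unramified
    odd [p] with [p ^ 2 <= d] only carries ideals equivalent to the prime above 2
    itself, under the hypothesis on even squares. *)
Definition exceptional (d x p : nat) : Prop :=
  [/\ prime p, odd p, ~~ odd x, (0 < x < p)%N & d = (x ^ 2 + 2 * p ^ 2)%N].

Section Exceptional.
Variables d q1 q2 : nat.
Hypothesis dE : d = (2 * (q1 * q2))%N.
Hypothesis q_odd : odd (q1 * q2).
Hypothesis d_sqfree : squarefree d.
Hypothesis q1P : one_or_prime q1.
Hypothesis q2P : one_or_prime q2.

(* The cross differences, for [sg = 1], and cross sums, for [sg = - 1], of two
   solutions [(x1, p1)] and [(x2, p2)]. *)
Let cross (sg : int) (x1 p1 x2 p2 : nat) : int := x1%:Z * p2 - sg * (x2%:Z * p1).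

Let coprime_q : coprime q1 q2.
Proof.
by apply: (coprime_of_mul_dvd d_sqfree); [lia | rewrite dE dvdn_mull].
Qed.

Let cross_mul x1 p1 x2 p2 : exceptional d x1 p1 -> exceptional d x2 p2 ->
  cross 1 x1 p1 x2 p2 * cross (- 1) x1 p1 x2 p2 = d%:Z * (p2%:Z ^+ 2 - p1%:Z ^+ 2).
Proof.
move=> [_ _ _ _ e1] [_ _ _ _ e2].
have -> : d%:Z * (p2%:Z ^+ 2 - p1%:Z ^+ 2) =
  d%:Z * p2%:Z ^+ 2 - d%:Z * p1%:Z ^+ 2 by ring.
by rewrite {1}e1 e2 -!mulnn !PoszD !PoszM /cross; ring.
Qed.

Let dvd_cross q x1 p1 x2 p2 : one_or_prime q -> (q %| d)%N ->
  exceptional d x1 p1 -> exceptional d x2 p2 ->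
  exists2 sg, (sg = 1 \/ sg = - 1) & (q %| cross sg x1 p1 x2 p2)%Z.
Proof.
move=> qP qd h1 h2.
have : (q%:Z %| cross 1 x1 p1 x2 p2 * cross (- 1) x1 p1 x2 p2)%Z.
  by rewrite cross_mul // dvdz_mulr.
case: qP => [->|pq]; first by exists 1; [left | rewrite dvd1z].
rewrite !dvdzE abszM Euclid_dvdM // => /orP [] h; [exists 1|exists (- 1)] => //.
  by left.
by right.
Qed.

Let not_dvd_cross sg x1 p1 x2 p2 : sg = 1 \/ sg = - 1 ->
  exceptional d x1 p1 -> exceptional d x2 p2 -> p1 != p2 ->
  (q1 %| cross sg x1 p1 x2 p2)%Z -> ~~ (q2 %| cross sg x1 p1 x2 p2)%Z.
Proof.
move=> sgP h1 h2 p12 d1; apply/negP => d2.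
have [[_ _ ex1 /andP [x10 xp1] e1] [_ _ ex2 /andP [x20 xp2] e2]] := (h1, h2).
have d_cross : (d %| `|cross sg x1 p1 x2 p2|)%N.
  have ev x : ~~ odd x -> (2 %| x%:Z)%Z by rewrite dvdzE dvdn2.
  have c2 : (2 %| cross sg x1 p1 x2 p2)%Z.
    by apply: rpredB; [|apply: dvdz_mull]; rewrite dvdz_mulr ?ev.
  rewrite !dvdzE in c2 d1 d2.
  by rewrite dE Gauss_dvd ?coprime2n // Gauss_dvd // c2 d1 d2.
have c0 : cross sg x1 p1 x2 p2 != 0.
  have : cross 1 x1 p1 x2 p2 * cross (- 1) x1 p1 x2 p2 != 0.
    rewrite cross_mul // subr_sqr !mulf_neq0 //.
    - by rewrite eqz_nat -lt0n dE [(0 < _)%N]muln_gt0 (odd_gt0 q_odd).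
    - by rewrite subr_eq0 eqz_nat eq_sym.
    - by rewrite -PoszD eqz_nat -lt0n addn_gt0 (leq_ltn_trans (leq0n x2) xp2).
  by rewrite mulf_eq0 negb_or => /andP []; case: sgP => ->.
move: d_cross => /dvdn_leq; rewrite absz_gt0 => /(_ c0).
rewrite leqNgt => /negP; apply.
have le1 : (x1 * p2 <= p1 * p2)%N by rewrite leq_mul2r ltnW ?orbT.
have le2 : (x2 * p1 <= p1 * p2)%N by rewrite mulnC leq_mul2l ltnW ?orbT.
(* [x1 p2 + x2 p1 <= 2 p1 p2 <= p1 ^ 2 + p2 ^ 2 < d]. *)
have le_d : (x1 * p2 + x2 * p1 < d)%N.
  have x1sq : (0 < x1 ^ 2)%N by rewrite expn_gt0 x10.
  have := (nat_Cauchy p1 p2).1; move: e1 e2 le1 le2 x1sq.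
  move: (x1 ^ 2)%N (x2 ^ 2)%N (p1 ^ 2)%N (p2 ^ 2)%N (x1 * p2)%N (x2 * p1)%N (p1 * p2)%N.
  by lia.
rewrite /cross -!PoszM; move: le_d sgP; move: (x1 * p2)%N (x2 * p1)%N.
by clear=> a b le_d [] ->; lia.
Qed.

Let cross_trans q sg tau x1 p1 x2 p2 x3 p3 :
  (q %| d)%N -> exceptional d x2 p2 ->
  (q%:Z %| cross sg x1 p1 x2 p2)%Z -> (q%:Z %| cross tau x2 p2 x3 p3)%Z ->
  (q%:Z %| cross (sg * tau) x1 p1 x3 p3)%Z.
Proof.
move=> qd [pp2 op2 _ /andP [x0 xp] e2] h1 h2.
have co : coprimez q p2.
  rewrite coprimezE /= coprime_sym; apply: coprime_dvdr qd _.
  rewrite prime_coprime // e2 dvdn_addl; last by rewrite dvdn_mull // dvdn_exp.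
  rewrite Euclid_dvdX //; apply/negP => /andP [/dvdn_leq]; lia.
rewrite -(Gauss_dvdzr _ co).
have -> : p2%:Z * cross (sg * tau) x1 p1 x3 p3 =
  p3%:Z * cross sg x1 p1 x2 p2 + sg * p1%:Z * cross tau x2 p2 x3 p3.
  by rewrite /cross; ring.
by rewrite rpredD // dvdz_mull.
Qed.

(** A solution [(x, p)] of [d = x ^ 2 + 2 p ^ 2] selects a square root [x / p] of
    [- 2] modulo [q1] and one modulo [q2].  For two solutions the roots agree
    up to sign modulo each [q_i]; since [d] cannot divide [x1 p2 - x2 p1] nor
    [x1 p2 + x2 p1], the two signs are opposite.  As signs multiply, this
    cannot hold for all three pairs out of three solutions. *)
Lemma exceptional_at_most_two x1 p1 x2 p2 x3 p3 :
  exceptional d x1 p1 -> exceptional d x2 p2 -> exceptional d x3 p3 ->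
  [|| p1 == p2, p2 == p3 | p1 == p3].
Proof.
move=> h1 h2 h3; rewrite -[_ || _]negbK !negb_or; apply/negP => /and3P [n12 n23 n13].
have q1d : (q1 %| d)%N by rewrite dE mulnCA dvdn_mulr.
have q2d : (q2 %| d)%N by rewrite dE mulnA dvdn_mull.
have opp a p b q : exceptional d a p -> exceptional d b q -> p != q ->
  exists sg, [/\ sg = 1 \/ sg = - 1, (q1 %| cross sg a p b q)%Z
    & (q2 %| cross (- sg) a p b q)%Z].
  move=> ha hb npq; have [sg sgP d1] := dvd_cross q1P q1d ha hb.
  have [tau tauP d2] := dvd_cross q2P q2d ha hb.
  have d12 := not_dvd_cross sgP ha hb npq d1.
  exists sg; split=> //; move: d12 d2; case: sgP => ->; case: tauP => -> d12 d2 //.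
  - by rewrite d2 in d12.
  - by rewrite d2 in d12.
have [sg [sgP a1 a2]] := opp _ _ _ _ h1 h2 n12.
have [tau [tauP b1 b2]] := opp _ _ _ _ h2 h3 n23.
have stP : sg * tau = 1 \/ sg * tau = - 1.
  by case: sgP tauP => -> [] ->; [left|right|right|left].
have := not_dvd_cross stP h1 h3 n13 (cross_trans q1d h2 a1 b1).
by rewrite -[sg * tau]mulrNN (cross_trans q2d h2 a2 b2).
Qed.

End Exceptional.

(** * Ideal classes generated by three ideals *)

Section GeneratedClasses.
Local Open Scope classical_set_scope.
Variable K : fieldExtType rat.
Local Notation O := (@integer_ring K).
Local Notation "I ** J" := (ideal_prod I J) (at level 40, left associativity).
Local Notation "I ~ J" := (ideal_equiv I J) (at level 70).
Variables A B C : set K.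
Hypotheses (hA : nonzero_ideal A) (hB : nonzero_ideal B) (hC : nonzero_ideal C).
Hypothesis A2 : ideal_exp A 2 ~ O.
Hypothesis B4 : ideal_exp B 4 ~ O.
Hypothesis C2 : ideal_exp C 2 ~ O.

Definition monomial (g : 'Z_2 * 'Z_4 * 'Z_2) : set K :=
  ideal_exp A g.1.1 ** ideal_exp B g.1.2 ** ideal_exp C g.2.

Lemma nonzero_ideal_monomial g : nonzero_ideal (monomial g).
Proof. by do 2?apply: nonzero_ideal_prod; apply: nonzero_ideal_exp. Qed.

Lemma monomial1 : monomial 1%g = O.
Proof. by rewrite /monomial /= !ideal_prod1 //; apply: nonzero_ideal_O. Qed.

Lemma monomialM g h : monomial (g * h)%g ~ monomial g ** monomial h.
Proof.
rewrite /monomial ideal_prodACA (ideal_prodACA (ideal_exp A _)) -!ideal_expD //.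
apply: ideal_equiv_sym; do 2?apply: ideal_equiv_prod.
- exact: ideal_exp_mod A2.
- exact: ideal_exp_mod B4.
- exact: ideal_exp_mod C2.
Qed.

(** The ideals whose class lies in the subgroup generated by [A], [B] and [C]. *)
Definition generated (I : set K) : Prop :=
  nonzero_ideal I /\ exists g, I ~ monomial g.

Lemma generated_equiv I J : nonzero_ideal I -> I ~ J -> generated J -> generated I.
Proof. by move=> hI e [_ [g eg]]; split=> //; exists g; rewrite e. Qed.

Lemma generated_prod I J : generated I -> generated J -> generated (I ** J).
Proof.
move=> [hI [g eg]] [hJ [h eh]]; split; first exact: nonzero_ideal_prod.
by exists (g * h)%g; rewrite monomialM eg eh; reflexivity.
Qed.

Lemma generated_cancel I J :
  generated I -> nonzero_ideal J -> generated (I ** J) -> generated J.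
Proof.
move=> [hI [g eg]] hJ [_ [h eh]]; split=> //; exists (g^-1 * h)%g.
rewrite monomialM -eh eg ideal_prodA -monomialM mulVg monomial1 ideal_prod1 //.
reflexivity.
Qed.

Lemma generated_O : generated O.
Proof.
split; first exact: nonzero_ideal_O.
by exists 1%g; rewrite monomial1; reflexivity.
Qed.

Lemma generated_inv I J :
  generated I -> nonzero_ideal J -> I ** J ~ O -> generated J.
Proof.
move=> gI hJ e; apply: (generated_cancel gI hJ); apply: generated_equiv e generated_O.
by apply: nonzero_ideal_prod => //; case: gI.
Qed.

Lemma generated_exp I n : generated I -> generated (ideal_exp I n).
Proof.
by move=> gI; elim: n => [|n IH]; [exact: generated_O | exact: generated_prod].
Qed.

Lemma generated_A : generated A.
Proof.
split=> //; exists (Zp1, 0, 0); rewrite /monomial /=.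
rewrite !(ideal_prodC _ O) !ideal_prod1 //; first by reflexivity.
Qed.

Lemma generated_B : generated B.
Proof.
split=> //; exists (0, Zp1, 0); rewrite /monomial /=.
rewrite !(ideal_prodC _ O) !ideal_prod1 //; first by reflexivity.
Qed.

Lemma generated_C : generated C.
Proof.
split=> //; exists (0, 0, Zp1); rewrite /monomial /=.
rewrite !(ideal_prodC _ O) !ideal_prod1 //; first by reflexivity.
exact: nonzero_ideal_O.
Qed.

Lemma generated_class_number :
  (forall I, nonzero_ideal I -> generated I) -> (class_number K %| 16)%N.
Proof.
move=> gen; have -> : 16%N = #|{: 'Z_2 * 'Z_4 * 'Z_2}|.
  by rewrite !card_prod !card_ord.
apply: (class_number_dvd_card (f := monomial)).
- exact: nonzero_ideal_monomial.
- by rewrite monomial1; reflexivity.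
- exact: monomialM.
- by move=> I /gen [].
Qed.

End GeneratedClasses.

(** * Generating the classes of small norm *)

Section ClassGroup.
Local Open Scope classical_set_scope.
Variables (K : fieldExtType rat) (d : nat) (s : K).
Hypothesis d_mod4 : d = 2 %[mod 4].
Hypothesis d_sqfree : squarefree d.
Hypothesis s_sqr : s ^+ 2 = d%:R.
Hypothesis K_gen : <<1; s>>%VS = fullv.
Local Notation O := (@integer_ring K).
Local Notation latt := (latt s).
Local Notation "I ** J" := (ideal_prod I J) (at level 40, left associativity).
Local Notation "I ~ J" := (ideal_equiv I J) (at level 70).
Local Notation T := (latt 2 0).

Let idl := nonzero_ideal_latt d_mod4 d_sqfree s_sqr K_gen.
Let lprod := latt_prod d_mod4 d_sqfree s_sqr K_gen.
Let lconj := latt_conj d_mod4 d_sqfree s_sqr K_gen.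
Let lflip := latt_flip d_mod4 d_sqfree s_sqr K_gen.
Let l1 := latt1 d_mod4 d_sqfree s_sqr K_gen.

Lemma PoszX (n k : nat) : (n ^ k)%N = n%:Z ^+ k :> int.
Proof. by rewrite -[n in LHS]/(`|n%:Z|)%N -abszX gez0_abs // exprn_ge0. Qed.

Lemma nonzero_ideal_two : nonzero_ideal T.
Proof. by apply: (idl (e := - (d %/ 2)%N%:Z)) => //; lia. Qed.

Lemma two_sqr : T ** T ~ O.
Proof.
have -> : T ** T = T ** latt 2 (- 0) by rewrite oppr0.
by apply: (lconj (e := - (d %/ 2)%N%:Z) (u := - (d %/ 4)%N%:Z)
  (v := 0) (w := - 1)) => //; lia.
Qed.

Lemma two_prod (N y e : int) : N = 1 %[mod 2]%Z -> y = 0 %[mod 2]%Z ->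
  d%:Z = y ^+ 2 - 2 * N * e -> T ** latt N y = latt (2 * N) y.
Proof.
move=> oN ey ee; have -> : T = latt 2 y.
  by rewrite -(latt_shift s 2 0 (y %/ 2)%Z); congr (latt _ _); lia.
have N0 : N != 0 by apply/eqP => N0; rewrite N0 in oN.
by apply: (lprod (e := e) (u := - (N %/ 2)%Z) (v := 1) (w := 0)) => //; lia.
Qed.

Lemma latt_exp (p y u w : int) (j : nat) (e : int) : p != 0 ->
  u * p + w * (2 * y) = 1 -> d%:Z = y ^+ 2 - p ^+ j * e ->
  latt (p ^+ j) y = ideal_exp (latt p y) j.
Proof.
move=> p0 bez; elim: j e => [|j IH] e ee; first by rewrite expr0 l1.
rewrite exprS /= -(IH (p * e)); last by rewrite ee (exprS p); ring.
apply/esym/(lprod (e := e) (u := u) (v := 0) (w := w)) => //.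
- by rewrite expf_neq0.
- by rewrite ee (exprS p).
- by rewrite -[RHS]bez; ring.
Qed.

(** The element [y + s] has norm [- 2 p ^ k], so it generates the product of the
    prime above 2 with the [k]-th power of a prime above [p]. *)
Lemma two_mul_exp (p k : nat) (y u w : int) : odd p -> y = 0 %[mod 2]%Z ->
  u * p%:Z + w * (2 * y) = 1 -> d%:Z = y ^+ 2 + 2 * p%:Z ^+ k ->
  T ** ideal_exp (latt p y) k ~ O.
Proof.
move=> op ey bez ee; have p0 : p%:Z != 0 by case: p op {bez ee}.
have opk : p%:Z ^+ k = 1 %[mod 2]%Z.
  by rewrite -modzXm; have -> : (p %% 2)%Z = 1; [lia | rewrite expr1n].
have pk0 : p%:Z ^+ k != 0 by rewrite expf_neq0.
rewrite -(latt_exp (e := - 2) p0 bez); last by rewrite ee; ring.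
rewrite (two_prod (e := - 1)) //; last by rewrite ee; ring.
have -> : O = latt (- 1) (- y) by rewrite lattN l1.
apply: lflip; first by rewrite mulf_neq0.
by rewrite ee; ring.
Qed.

Lemma prime_bezout (p : nat) (y : int) : prime p -> odd p -> ~~ (p %| y)%Z ->
  exists u w, u * p%:Z + w * (2 * y) = 1.
Proof.
move=> pp op py.
have : coprimez p (2 * y).
  rewrite coprimezE /= prime_coprime // abszM Euclid_dvdM // negb_or.
  apply/andP; split; last by rewrite dvdzE in py.
  by rewrite dvdn_prime2 //; apply/eqP => p2; rewrite p2 in op.
by case/coprimezP => -[u w] /= e; exists u, w.
Qed.

Section Generators.
Hypothesis hM : (M_even' d <= 2)%N.
Variables A B C : set K.
Hypotheses (hA : nonzero_ideal A) (hB : nonzero_ideal B) (hC : nonzero_ideal C).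
Hypothesis A2 : ideal_exp A 2 ~ O.
Hypothesis B4 : ideal_exp B 4 ~ O.
Hypothesis C2 : ideal_exp C 2 ~ O.
Local Notation gen := (generated A B C).
Hypothesis gen_two : gen T.
Hypothesis gen_ram : forall N : nat, odd N -> (N %| d)%N -> gen (latt N 0).
Hypothesis gen_exc : forall x p : nat, exceptional d x p -> gen (latt p x).

(** After reduction modulo [p], up to conjugation, [x] is even with [0 < x < p].
    Then [d - y ^ 2 = 2 p] for [y = x] or [y = 2 p - x], in which case the ideal
    is an inverse of the prime above 2 or the conjugate of one, unless [(x, p)]
    is exceptional. *)
Lemma generated_prime (p : nat) (x f : int) : prime p -> odd p ->
  (p ^ 2 <= d)%N -> d%:Z = x ^+ 2 - p%:Z * f -> ~~ (p %| x)%Z ->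
  gen (latt p x).
Proof.
move=> pp op pd ex px; have p0 : 0 < p%:Z by rewrite ltz_nat prime_gt0.
have idp (y g : int) : d%:Z = y ^+ 2 - p%:Z * g -> nonzero_ideal (latt p y).
  by move=> eg; apply: (idl (e := g)) => //; rewrite gt_eqF.
have gen_conj (y g : int) : d%:Z = y ^+ 2 - p%:Z * g -> ~~ (p %| y)%Z ->
    gen (latt p y) -> gen (latt p (- y)).
  move=> eg py gy; apply: (generated_inv _ _ _ _ _ _ gy) => //.
    by apply: (idp _ g); rewrite sqrrN.
  have [u [w bez]] := prime_bezout pp op py.
  apply: (lconj (e := g) (u := u) (v := w) (w := 0)) => //.
    by rewrite gt_eqF.
  by rewrite -[RHS]bez; ring.
have gen_one (y : int) : y = 0 %[mod 2]%Z -> ~~ (p %| y)%Z ->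
    d%:Z = y ^+ 2 + 2 * p%:Z -> gen (latt p y).
  move=> ey py e; have [u [w bez]] := prime_bezout pp op py.
  have hy : nonzero_ideal (latt p y) by apply: (idp _ (- 2)); rewrite e; ring.
  apply: (generated_inv _ _ _ _ _ _ gen_two) => //.
  by rewrite -(ideal_exp1 hy); apply: two_mul_exp bez _ => //; rewrite expr1.
(* Of the residues [r] and [p - r] of [x] and [- x] exactly one is even. *)
have [y [k [xy yp y0 ey]]] : exists (y : nat) (k : int),
    [/\ x = y%:Z + k * p%:Z \/ x = - y%:Z + k * p%:Z, (y < p)%N, (0 < y)%N & ~~ odd y].
  have r0 := modz_ge0 x (lt0r_neq0 p0); have r1 := ltz_pmod x p0.
  have e1 := divz_eq x p; have rN : (x %% p)%Z != 0.
    by apply: contra px => /eqP r; apply/dvdz_mod0P.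
  have [er|er] := boolP (odd `|(x %% p)%Z|).
    exists `|p%:Z - (x %% p)%Z|%N, ((x %/ p)%Z + 1); split; [right|..].
    - by rewrite {1}e1 gez0_abs; [ring | lia].
    - by lia.
    - by lia.
    - by lia.
  exists `|(x %% p)%Z|%N, (x %/ p)%Z; split; [left|..] => //.
  - by rewrite {1}e1 gez0_abs // addrC.
  - by lia.
  - by lia.
have [g eg] : exists g, d%:Z = y%:Z ^+ 2 - p%:Z * g.
  case: xy => xy.
    by exists (f - k * (2 * y%:Z + k * p%:Z)); rewrite ex xy; ring.
  by exists (f - k * (- 2 * y%:Z + k * p%:Z)); rewrite ex xy; ring.
have py : ~~ (p %| y%:Z)%Z by rewrite dvdzE /=; apply/negP => /dvdn_leq; lia.
suff gy : gen (latt p y).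
  case: xy => ->; rewrite latt_shift //.
  exact: gen_conj eg py gy.
have ey2 : y%:Z = 0 %[mod 2]%Z by lia.
have y2d : (y ^ 2 <= d)%N by apply: leq_trans pd; rewrite leq_exp2r // ltnW.
have pdy : (p %| d - y ^ 2)%N.
  have : (p%:Z %| (d - y ^ 2)%N%:Z)%Z.
    have -> : (d - y ^ 2)%N%:Z = p%:Z * - g by rewrite -subzn // eg -mulnn PoszM; ring.
    by rewrite dvdz_mulr.
  by rewrite dvdzE.
case: (prime_square_complement d_mod4 hM pp op ey _ pd pdy) => [|e|e|e].
- by rewrite y0 yp.
- by apply: gen_one => //; rewrite {1}e -mulnn !PoszD !PoszM; ring.
- have ez : ((2 * p - y)%N%:Z = 2 * p%:Z - y%:Z)%R by clear -yp; lia.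
  rewrite -[y%:Z]opprK; apply: (gen_conj (- y%:Z) g).
  + by rewrite sqrrN.
  + by rewrite rpredN.
  rewrite -(latt_shift s p (- y%:Z) 2); apply: gen_one.
  + by clear -ey2; lia.
  + by rewrite rpredDr ?rpredN // dvdz_mull.
  + by rewrite {1}e -mulnn !PoszD !PoszM ez; ring.
- by apply: gen_exc; split; rewrite ?y0.
Qed.

(** After reduction modulo [N], [x] is even with [|x| < N].  If [x = 0] then [N]
    divides [d] and the ideal is a product of ramified primes; otherwise [N]
    divides [d - x ^ 2], which has a single odd prime factor, and the ideal is a
    power of a prime. *)
Lemma generated_odd (N : nat) (x f : int) : odd N -> (N ^ 2 <= d)%N ->
  d%:Z = x ^+ 2 - N%:Z * f -> gen (latt N x).
Proof.
move=> oN Nd; have N0 : 0 < N%:Z by case: N oN {Nd}.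
wlog [ex xN] : x f / x = 0 %[mod 2]%Z /\ `|x| < N%:Z.
  move=> wl ef; have r0 := modz_ge0 x (lt0r_neq0 N0); have r1 := ltz_pmod x N0.
  have e1 := divz_eq x N.
  have [y [k [xy ey yN]]] : exists y k : int,
      [/\ y = x + k * N%:Z, y = 0 %[mod 2]%Z & `|y| < N%:Z].
    have [er|er] := eqVneq ((x %% N)%Z %% 2)%Z 0.
      exists (x %% N)%Z, (- (x %/ N)%Z); split; last by lia.
        by rewrite {2}e1; ring.
      by lia.
    exists ((x %% N)%Z - N%:Z), (- (x %/ N)%Z - 1); split.
    - by rewrite {2}e1; ring.
    - by lia.
    - by lia.
  rewrite -(latt_shift s N x k) -xy; apply: (wl y (f + k * (2 * x + k * N%:Z))) => //.
  by rewrite ef xy; ring.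
move=> ef; have [x0|x0] := eqVneq x 0.
  rewrite x0; apply: gen_ram => //.
  have : (N%:Z %| d%:Z)%Z by rewrite ef x0 expr0n sub0r rpredN dvdz_mulr.
  by rewrite dvdzE.
have xd : (`|x| ^ 2 <= d)%N by apply: leq_trans Nd; rewrite leq_exp2r //; lia.
have [||p [k [pp op e]]] := even_square_complement d_mod4 hM _ _ xd; try by lia.
have eZ : d%:Z = x ^+ 2 + 2 * p%:Z ^+ k.
  by rewrite {1}e -abszX PoszD PoszM PoszX gez0_abs // sqr_ge0.
have : (N %| p ^ k)%N.
  rewrite -(@Gauss_dvdr N 2) ?coprimen2 //.
  have : (N%:Z %| (2 * p ^ k)%N%:Z)%Z.
    have -> : (2 * p ^ k)%N%:Z = N%:Z * - f.
      by apply: (@addrI _ (x ^+ 2)); rewrite PoszM PoszX -eZ ef; ring.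
    by rewrite dvdz_mulr.
  by rewrite dvdzE.
case/(dvdn_pfactor _ _ pp) => -[|j] jk eN; first by rewrite eN in xN; lia.
have [i ei] : exists i, k = i.+1 by exists k.-1; lia.
have px : ~~ (p %| x)%Z.
  rewrite dvdzE /=; apply/negP => pdx; have := dvdn_leq _ pdx.
  rewrite absz_gt0 => /(_ x0); case: i ei => [|i] ei.
    have j0 : j = 0%N by lia.
    by rewrite j0 expn1 in eN; lia.
  have /negP := squarefree_prime d_sqfree pp; case.
  rewrite {1}e dvdn_add ?dvdn_exp2r //.
  by rewrite dvdn_mull // ei dvdn_exp2l.
have pd : (p ^ 2 <= d)%N.
  by apply: leq_trans Nd; rewrite leq_exp2r // eN expnS leq_pmulr // expn_gt0 prime_gt0.
have [u [w bez]] := prime_bezout pp op px.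
have pN0 : p%:Z != 0 by have := prime_gt0 pp; lia.
have -> : latt N x = ideal_exp (latt p x) j.+1.
  by rewrite -(latt_exp (e := f) pN0 bez) -PoszX -eN.
apply: generated_exp => //; apply: (generated_prime (f := - 2 * p%:Z ^+ i)) => //.
by rewrite eZ ei (exprS p%:Z); ring.
Qed.

(** A reduced ideal has odd norm or is the product of the prime above 2 with one
    of odd norm: 4 cannot divide [y ^ 2 - d], as [d] is 2 modulo 4. *)
Lemma generated_all I : nonzero_ideal I -> gen I.
Proof.
move=> hI.
have [M [y [f [M0 Md ef eI]]]] := reduced_latt d_mod4 d_sqfree s_sqr K_gen hI.
apply: (generated_equiv hI eI).
have [N eM] : exists N : nat, M = N%:Z by exists `|M|%N; rewrite gtz0_abs.
rewrite {M}eM in M0 Md ef eI *; have Nd : (N ^ 2 <= d)%N by rewrite -lez_nat PoszX.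
have [oN|eN] := boolP (odd N); first exact: generated_odd ef.
have [N' eN'] : exists N', N = (2 * N')%N by exists N./2; lia.
move: M0 Nd ef {eI Md eN}; rewrite {N}eN' => M0 Nd ef.
have [y' ey] : exists y', y = 2 * y'.
  exists (y %/ 2)%Z; suff : (y %% 2)%Z != 1 by lia.
  apply/eqP => y1; have ey : y = 2 * (y %/ 2)%Z + 1 by lia.
  by move: ef; rewrite {1}ey PoszM; lia.
have oN : odd N'.
  apply/negPn/negP => eN; have [N2 e2] : exists N2, N' = (2 * N2)%N.
    by exists N'./2; lia.
  by move: ef; rewrite ey e2 !PoszM; lia.
rewrite PoszM -(@two_prod _ y f); [|lia|lia|by rewrite ef PoszM].
apply: generated_prod => //; apply: (generated_odd (f := 2 * f)) => //.
  by apply: leq_trans Nd; rewrite leq_exp2r //; lia.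
by rewrite ef PoszM; ring.
Qed.

End Generators.
End ClassGroup.

(** * The generators *)

Section Choice.
Local Open Scope classical_set_scope.
Variables (K : fieldExtType rat) (d : nat) (s : K).
Hypothesis d_mod4 : d = 2 %[mod 4].
Hypothesis d_sqfree : squarefree d.
Hypothesis s_sqr : s ^+ 2 = d%:R.
Hypothesis K_gen : <<1; s>>%VS = fullv.
Local Notation O := (@integer_ring K).
Local Notation latt := (latt s).
Local Notation "I ** J" := (ideal_prod I J) (at level 40, left associativity).
Local Notation "I ~ J" := (ideal_equiv I J) (at level 70).
Local Notation T := (latt 2 0).

Let idl := nonzero_ideal_latt d_mod4 d_sqfree s_sqr K_gen.
Let lprod := latt_prod d_mod4 d_sqfree s_sqr K_gen.
Let lconj := latt_conj d_mod4 d_sqfree s_sqr K_gen.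
Let lflip := latt_flip d_mod4 d_sqfree s_sqr K_gen.
Let l1 := latt1 d_mod4 d_sqfree s_sqr K_gen.
Let hT := nonzero_ideal_two d_mod4 d_sqfree s_sqr K_gen.
Let T2 := two_sqr d_mod4 d_sqfree s_sqr K_gen.

Lemma exceptional_ideal (x p : nat) : exceptional d x p ->
  nonzero_ideal (latt p x) /\ ideal_exp (latt p x) 2 ~ T.
Proof.
move=> [pp op ex /andP [x0 xp] e].
have eZ : d%:Z = x%:Z ^+ 2 + 2 * p%:Z ^+ 2 by rewrite {1}e PoszD PoszM !PoszX.
have px : ~~ (p %| x%:Z)%Z by rewrite dvdzE /=; apply/negP => /dvdn_leq; lia.
have [u [w bez]] := prime_bezout pp op px.
have hP : nonzero_ideal (latt p x).
  by apply: (idl (e := - 2 * p%:Z)); [lia | rewrite eZ; ring].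
split=> //; have ex2 : x%:Z = 0 %[mod 2]%Z by lia.
have e1 := two_mul_exp d_mod4 d_sqfree s_sqr K_gen op ex2 bez eZ.
rewrite -[ideal_exp _ _]ideal_prod1; last exact: nonzero_ideal_exp.
by rewrite -T2 -ideal_prodA e1 ideal_prodC ideal_prod1 //; reflexivity.
Qed.

Lemma exp4_of_sqr_two (I : set K) : nonzero_ideal I -> ideal_exp I 2 ~ T ->
  ideal_exp I 4 ~ O.
Proof. by move=> hI e; rewrite -[4%N]/(2 + 2)%N ideal_expD // e. Qed.

Lemma exp_O n : ideal_exp O n = O.
Proof.
elim: n => // n IH; rewrite -[LHS]/(ideal_prod O (ideal_exp O n)) IH.
by rewrite ideal_prod1 //; apply: nonzero_ideal_O.
Qed.

(** The exceptional primes give at most two ideals [P] and [P'], both with square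
    equivalent to the prime above 2; they generate the same classes as [P], of
    order dividing 4, and [P P'], of order dividing 2. *)
Lemma exceptional_generators (q1 q2 : nat) :
  d = (2 * (q1 * q2))%N -> odd (q1 * q2) -> one_or_prime q1 -> one_or_prime q2 ->
  exists B C : set K, [/\ nonzero_ideal B, nonzero_ideal C,
    ideal_exp B 4 ~ O, ideal_exp C 2 ~ O &
    forall A, nonzero_ideal A -> ideal_exp A 2 ~ O ->
      generated A B C T /\
      forall x p, exceptional d x p -> generated A B C (latt p x)].
Proof.
move=> dE oq q1P q2P; have hO := nonzero_ideal_O K.
have exc_inj x x' p : exceptional d x p -> exceptional d x' p -> x = x'.
  move=> [_ _ _ _ e] [_ _ _ _]; rewrite {1}e => /addIn /eqP.
  by rewrite eqn_exp2r // => /eqP.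
have [[x1 [p1 h1]]|none] := pselect (exists x p, exceptional d x p); last first.
  (* Without exceptional primes the prime above 2 itself takes the place of [P]. *)
  exists T, O; split=> //.
  - rewrite -[4%N]/(2 + 2)%N ideal_expD // !ideal_exp2 // !T2.
    by rewrite ideal_prod1 //; reflexivity.
  - by rewrite exp_O; reflexivity.
  move=> A hA A2; split; first exact: generated_B.
  by move=> x p h; case: none; exists x, p.
have [hP1 P1T] := exceptional_ideal h1.
have P14 := exp4_of_sqr_two hP1 P1T.
have [[x2 [p2 [h2 /eqP n12]]]|none] :=
    pselect (exists x p, exceptional d x p /\ p1 <> p); last first.
  exists (latt p1 x1), O; split=> //; first by rewrite exp_O; reflexivity.
  move=> A hA A2; have gB : generated A (latt p1 x1) O (latt p1 x1).
    exact: generated_B.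
  split.
    apply: (@generated_equiv _ _ _ _ _ (ideal_exp (latt p1 x1) 2)) => //.
    - by rewrite P1T; reflexivity.
    - by apply: generated_exp => //; rewrite exp_O; reflexivity.
  move=> x p h; have [ep|np] := eqVneq p1 p; last first.
    by case: none; exists x, p; split=> //; apply/eqP.
  by move: h; rewrite -ep => h; rewrite (exc_inj _ _ _ h h1).
have [hP2 P2T] := exceptional_ideal h2.
have hC := nonzero_ideal_prod hP1 hP2.
have C2 : ideal_exp (latt p1 x1 ** latt p2 x2) 2 ~ O.
  by rewrite ideal_exp2 // ideal_prodACA -!ideal_exp2 // P1T P2T.
exists (latt p1 x1), (latt p1 x1 ** latt p2 x2); split=> // A hA A2.
have gB : generated A (latt p1 x1) (latt p1 x1 ** latt p2 x2) (latt p1 x1).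
  exact: generated_B.
split.
  apply: (@generated_equiv _ _ _ _ _ (ideal_exp (latt p1 x1) 2)) => //.
  - by rewrite P1T; reflexivity.
  - exact: generated_exp.
move=> x p h.
have := exceptional_at_most_two dE oq d_sqfree q1P q2P h1 h2 h.
rewrite (negPf n12) /= => /orP [] /eqP ep; move: h; rewrite -ep => h.
  rewrite (exc_inj _ _ _ h h2); apply: (generated_cancel _ _ _ _ _ _ gB) => //.
  exact: generated_C.
by rewrite (exc_inj _ _ _ h h1).
Qed.

(** An odd divisor of [d = 2 q1 q2] is a product of some of the [qi], and the
    primes above [2], [q1] and [q2] multiply to the principal ideal [(s)]. *)
Lemma generated_ramified (q1 q2 : nat) (A B C : set K) :
  d = (2 * (q1 * q2))%N -> odd (q1 * q2) -> one_or_prime q1 -> one_or_prime q2 ->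
  A = latt q1 0 ->
  nonzero_ideal A -> nonzero_ideal B -> nonzero_ideal C ->
  ideal_exp A 2 ~ O -> ideal_exp B 4 ~ O -> ideal_exp C 2 ~ O ->
  generated A B C T ->
  forall N : nat, odd N -> (N %| d)%N -> generated A B C (latt N 0).
Proof.
move=> dE oq q1P q2P eA hA hB hC A2 B4 C2 gT.
have q0 : (0 < q1 * q2)%N by case: (q1 * q2)%N oq.
have [q10 q20] : (0 < q1)%N /\ (0 < q2)%N by apply/andP; rewrite -muln_gt0.
have hdiv (N : nat) : (0 < N)%N -> (N %| d)%N -> nonzero_ideal (latt N 0).
  move=> N0 /dvdnP [e ee]; apply: (idl (e := - e%:Z)); first by lia.
  by rewrite {1}ee PoszM; ring.
have g1 : generated A B C (latt 1 0) by rewrite l1; apply: generated_O.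
have gq1 : generated A B C (latt q1 0) by rewrite -eA; exact: generated_A.
have gq : generated A B C (latt (q1 * q2)%N 0).
  apply: (generated_inv _ _ _ _ _ _ gT) => //.
    by apply: hdiv => //; rewrite dE dvdn_mull.
  rewrite (two_prod d_mod4 d_sqfree s_sqr K_gen (e := - 1));
    [|lia|by []|by rewrite {1}dE !PoszM; ring].
  have -> : O = latt (- 1) (- 0) by rewrite lattN l1.
  by apply: lflip; [lia|rewrite {1}dE !PoszM; ring].
have co : coprime q1 q2.
  by apply: (coprime_of_mul_dvd d_sqfree) => //; rewrite dE dvdn_mull.
have gq2 : generated A B C (latt q2 0).
  apply: (generated_cancel _ _ _ _ _ _ gq1) => //.
    by apply: hdiv => //; rewrite dE mulnA dvdn_mull.
  have /coprimezP [[u v] /= bez] : coprimez q1 q2 by rewrite coprimezE.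
  by rewrite (lprod (e := - 2) (u := u) (v := v) (w := 0)) -?PoszM //; lia.
move=> N oN Nd.
have {Nd} Nq : (N %| q1 * q2)%N by rewrite -(@Gauss_dvdr N 2) ?coprimen2 // -dE.
have step q M : one_or_prime q -> (M %| q)%N -> M = 1%N \/ M = q.
  move=> [->|pq]; first by rewrite dvdn1 => /eqP; left.
  by move/(prime_nt_dvdP pq) => h; case: (eqVneq M 1%N) => [|/h]; [left|right].
have [/dvdnP [M eM]|n1] := boolP (q1 %| N)%N.
  have : (M %| q2)%N by rewrite -(dvdn_pmul2l q10) mulnC -eM.
  by case/(step _ _ q2P) => e; rewrite eM e ?mul1n // mulnC.
have : (N %| q2)%N.
  case: q1P n1 => [->|pq1 n1]; first by rewrite dvd1n.
  by move: Nq; rewrite Gauss_dvdr // coprime_sym prime_coprime.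
by case/(step _ _ q2P) => ->.
Qed.

End Choice.

Theorem theorem9 (d : nat) (d_gt0 : (0 < d)%N) (d_mod4 : d = 2 %[mod 4])
    (d_sqfree : squarefree d)
    (K : fieldExtType rat) (s : K) (s_sqr : s ^+ 2 = d%:R)
    (K_gen : <<1; s>>%VS = fullv)
    (hM : (M_even' d <= 2)%N) :
  (class_number K %| 16)%N.
Proof.
have [q1 [q2 [dE oq q1P q2P]]] := two_odd_primes d_mod4 d_sqfree hM.
have [B [C [hB hC B4 C2 gen]]] :=
  exceptional_generators d_mod4 d_sqfree s_sqr K_gen dE oq q1P q2P.
have q10 : q1%:Z != 0 by case: q1 oq {dE q1P}.
have eA : d%:Z = 0 ^+ 2 - q1%:Z * (- 2 * q2%:Z) by rewrite {1}dE !PoszM; ring.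
have hA := nonzero_ideal_latt d_mod4 d_sqfree s_sqr K_gen q10 eA.
have A2 : ideal_equiv (ideal_exp (latt s q1 0) 2) (@integer_ring K).
  rewrite ideal_exp2 //; have : coprimez q1 (- 2 * q2%:Z).
    have co : coprime q1 q2.
      apply: (coprime_of_mul_dvd d_sqfree); last by rewrite dE dvdn_mull.
      by case: q2 oq {dE q2P eA}; rewrite ?muln0.
    rewrite coprimezE abszM coprimeMr /= co coprimen2 andbT.
    by move: oq; rewrite oddM => /andP [].
  case/coprimezP => -[u w] /= bez.
  have bez0 : u * q1%:Z + 0 * (2 * 0) + w * (- 2 * q2%:Z) = 1.
    by rewrite -[RHS]bez; ring.
  by have := latt_conj d_mod4 d_sqfree s_sqr K_gen q10 eA bez0; rewrite oppr0.
have [genT genE] := gen _ hA A2.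
have genR := generated_ramified d_mod4 d_sqfree s_sqr K_gen dE oq q1P q2P
  erefl hA hB hC A2 B4 C2 genT.
apply: (generated_class_number hA hB hC A2 B4 C2).
exact: generated_all genT genR genE.
Qed.
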